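(* Fix $W>0$ and consider the system $y_{t+1}=a\phi_b(y_t)+u_t+w_{t+1}$, $t\ge 0$, with disturbances satisfying $\sup_{t\ge1}|w_t|\le W$. (i) (Stabilization.) Let $\mathcal P\subset\mathbb R\times(0,\infty)$ be nonempty and compact, and put $\overline b=\max\{b:(a,b)\in\mathcal P\}$. If $\overline b\le 3\sqrt3/2$, then there is a feedback law (a single one, not depending on $Y$) such that for every $Y\ge0$ $$\sup_{\substack{p^\star\in\mathcal P,\ |y_0|\le Y\\ (w_k)_{k\ge1}:\ \sup_k|w_k|\le W}}\ \sup_{t\ge0}|y_t|<\infty .$$ In particular, $\mathcal P$ is robustly stabilizable. (ii) (Impossibility.) Let $p_0=(a_0,b_0)\in\mathbb R\times(0,\infty)$ with $b_0>3\sqrt3/2$. Then $p_0$ is not locally robustly stabilizable. More precisely, for every compact rectangle $Q\subset\mathbb R\times(0,\infty)$ with $p_0\in\operatorname{int}Q$, every feedback law and every $R_0>0$, there exist $p^\star\in Q$, $y_0\ge R_0$, a disturbance sequence $(w_t)_{t\ge1}$ with $\sup_{t\ge1}|w_t|\le W$, constants $c>0$ and $z>1$, and $T_0\in\mathbb N$ such that the resulting closed-loop trajectory (true parameter $p^\star$, initial state $y_0$, disturbances $(w_t)$) satisfies $$\log|y_t|\ge c z^t\qquad\text{for every } t\ge T_0 .$$ In particular, $\sup_{t\ge0}|y_t|=\infty$.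
   Context: For $b>0$ and $y\in\mathbb R$, $\phi_b(y)=\operatorname{sgn}(y)|y|^b$ (so $\phi_b(0)=0$). The state is $y_t\in\mathbb R$, the input is $u_t\in\mathbb R$, and the true parameter $p^\star=(a^\star,b^\star)\in\mathbb R\times(0,\infty)$ is unknown to the controller; trajectories are generated by $y_{t+1}=a^\star\phi_{b^\star}(y_t)+u_t+w_{t+1}$. A feedback law is a sequence $\mu=(\mu_t)_{t\ge0}$ of maps $\mu_t:\mathbb R^{t+1}\to\mathbb R$ (no regularity required) with $u_t=\mu_t(y_0,\ldots,y_t)$; it may depend on the prescribed parameter set and on $W$, but not on $p^\star$ or the disturbances. A nonempty set $\mathcal P\subset\mathbb R\times(0,\infty)$ is robustly stabilizable if there is a feedback law such that $\sup_{t\ge0}|y_t|<\infty$ for every $p^\star\in\mathcal P$, every $y_0\in\mathbb R$, and every disturbance sequence with $\sup_{t\ge1}|w_t|\le W$. A compact rectangle is a product of two compact intervals. A point $p_0\in\mathbb R\times(0,\infty)$ is locally robustly stabilizable if there is a compact rectangle $Q\subset\mathbb R\times(0,\infty)$ with $p_0\in\operatorname{int}Q$ that is robustly stabilizable. *)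

(* Defs.v *)
From mathcomp Require Import all_boot all_order all_algebra.
From mathcomp Require Import all_classical all_reals all_analysis.

Set Implicit Arguments.
Unset Strict Implicit.
Unset Printing Implicit Defensive.

Import Order.TTheory GRing.Theory Num.Theory.
Import numFieldNormedType.Exports.

Local Open Scope classical_set_scope.
Local Open Scope ring_scope.

Definition signed_pow (R : realType) (b y : R) : R := Num.sg y * `|y| `^ b.

(* The law at time t receives the whole output history (y_0, ..., y_t). *)
Definition feedback_law (R : realType) : Type :=
  forall t : nat, t.+1.-tuple R -> R.

Definition param_space (R : realType) : set (R * R) := [set p | 0 < p.2].

(* The pair p is (a, b).  Disturbances are indexed from 1: the value w 0 is
   never used. *)
Fixpoint history (R : realType) (mu : feedback_law R) (p : R * R) (y0 : R)
    (w : nat -> R) (t : nat) : t.+1.-tuple R :=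
  match t with
  | 0 => [tuple y0]
  | s.+1 =>
      let h := history mu p y0 w s in
      [tuple of rcons h
         (p.1 * signed_pow p.2 (tnth h ord_max) + mu s h + w s.+1)]
  end.

Definition trajectory (R : realType) (mu : feedback_law R) (p : R * R) (y0 : R)
    (w : nat -> R) (t : nat) : R :=
  tnth (history mu p y0 w t) ord_max.

Lemma history_trajectory (R : realType) (mu : feedback_law R) (p : R * R)
    (y0 : R) (w : nat -> R) (t : nat) :
  history mu p y0 w t = [tuple trajectory mu p y0 w i | i < t.+1].
Proof.
apply: eq_from_tnth => i; rewrite tnth_mktuple.
elim: t i => [|t IH] i; first by rewrite (ord1 i) /trajectory; congr tnth; apply/val_inj.
have [it|] := ltnP i t.+1.
  rewrite -(IH (Ordinal it)) !(tnth_nth 0) /= nth_rcons size_tuple it.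
  by [].
move=> ti; have -> : i = ord_max by apply/val_inj/eqP; rewrite eqn_leq ti -ltnS ltn_ord.
by [].
Qed.

Lemma trajectory0 (R : realType) (mu : feedback_law R) (p : R * R) (y0 : R)
    (w : nat -> R) :
  trajectory mu p y0 w 0 = y0.
Proof. by rewrite /trajectory (tnth_nth 0). Qed.

Lemma trajectoryS (R : realType) (mu : feedback_law R) (p : R * R) (y0 : R)
    (w : nat -> R) (t : nat) :
  trajectory mu p y0 w t.+1 =
    p.1 * signed_pow p.2 (trajectory mu p y0 w t)
    + mu t [tuple trajectory mu p y0 w i | i < t.+1] + w t.+1.
Proof.
rewrite -history_trajectory {1}/trajectory (tnth_nth 0) /=.
by rewrite nth_rcons size_tuple ltnn eqxx.
Qed.

Definition admissible_disturbance (R : realType) (W : R) (w : nat -> R) : Prop :=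
  forall t : nat, (1 <= t)%N -> `|w t| <= W.

Definition robustly_stabilizable (R : realType) (W : R) (P : set (R * R)) : Prop :=
  [/\ P !=set0, P `<=` @param_space R &
    exists mu : feedback_law R,
      forall (p : R * R) (y0 : R) (w : nat -> R),
        P p -> admissible_disturbance W w ->
        has_ubound (range (fun t => `|trajectory mu p y0 w t|))].

Definition compact_rectangle (R : realType) (Q : set (R * R)) : Prop :=
  exists a1 a2 b1 b2 : R,
    [/\ a1 <= a2, b1 <= b2 & Q = `[a1, a2] `*` `[b1, b2]].

Definition locally_robustly_stabilizable (R : realType) (W : R) (p0 : R * R) :
    Prop :=
  exists Q : set (R * R),
    [/\ compact_rectangle Q, Q `<=` @param_space R, interior Q p0 &
      robustly_stabilizable W Q].

(* Main.v *)
Require Import Defs.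
From mathcomp Require Import all_boot all_order all_algebra.
From mathcomp Require Import all_classical all_reals all_analysis.
From mathcomp Require Import ring lra zify.

Set Implicit Arguments.
Unset Strict Implicit.
Unset Printing Implicit Defensive.

Import Order.TTheory GRing.Theory Num.Theory.
Import numFieldNormedType.Exports.

Local Open Scope classical_set_scope.
Local Open Scope ring_scope.

(** Write [x_t = log |y_t|] and let [beta = 3 sqrt 3 / 2].  Since
    [log |a phi_b(y)|] is affine in [log |y|] with the unknown coefficients
    [(log |a|, b)], the transitions from two past outputs of log-sizes
    [s < r] reveal the drift there up to a bounded error, and extrapolating this
    error to the log-size [x] gives a prediction error of log-size about
    [b (x - s)].
    Along an expanding run this reads [x_{t+1} = b (x_t - x_{t-2})], whose
    characteristic equation [z^3 = b (z^2 - 1)] has a root [z > 1] exactly when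
    [b >= beta]; at [b = beta] the root [sqrt 3] is double.

    Impossibility ([adversary_forces_growth]).  At each time the adversary keeps
    the current parameter or tilts it around the previous output: the exponent
    goes up, the gain goes down, and the response at that output is unchanged.
    The tilt is so small that all older responses move by at most
    [kappa / 2^t], hence every output stays explainable by disturbances bounded
    by [W] under the limit parameter; yet it moves the response at the current
    output by [exp (b (x_t - x_{t-2}) - O(t))].  One of the two choices
    therefore makes the next output that large whatever the input is, and when
    [b > beta] the recursion forces [x_{t+1} >= sqrt 3 x_t]
    ([lacunary_growth]).

    Stabilization ([stabilization]). The law cancels the drift predicted by a
    parameter of largest exponent among those consistent with the past
    ([greedy_law]). The prediction error is then a difference of two
    exponentials in the log-size which is at most [2 W] at every past output,
    and is controlled by interpolation ([exp_gap_interp]) and extrapolation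
    ([exp_gap_extrap]). Followed along the milestones, the outputs whose
    log-size beats that of the previous milestone by the factor [6/5], the
    ratios of consecutive log-sizes are such that two ratios bounded by [rho]
    are followed by one bounded by [beta (1 - 1 / rho^2) <= rho], up to
    vanishing errors; in the critical case there is equality at [rho = sqrt 3],
    and this alone would not stop the growth. The choice of the largest exponent
    supplies what is missing. Either the true exponent lies below the maximum by
    a margin [eta] depending only on the bound [Y] on the initial state; then
    the extrapolated error gains the factor [exp (- eta (r - s))], the bound on
    the ratios drops by a fixed amount every few milestones, and so the number
    of milestones is bounded ([milestone_chain_short]). Or the true and the
    selected exponent differ by less than [eta]; then a single past output
    predicts the drift ([exp_gap_single]), so that [x_{t+1} <= beta (x_t -
    x_{t-1})] and a fourth milestone never occurs ([run_short]). In both cases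
    all outputs are bounded in terms of [Y]. *)

(** * Responses, runs and the critical exponent *)

Definition response (R : realType) (p : R * R) (y : R) : R :=
  p.1 * signed_pow p.2 y.

Lemma response_expR (R : realType) (p : R * R) (y : R) : y != 0 ->
  response p y = Num.sg y * (p.1 * expR (p.2 * ln `|y|)).
Proof.
move=> y0; rewrite /response /signed_pow /powR normr_eq0 (negbTE y0).
by rewrite mulrCA.
Qed.

Lemma norm_response (R : realType) (p : R * R) (y : R) : y != 0 ->
  `|response p y| = `|p.1| * expR (p.2 * ln `|y|).
Proof.
move=> y0; rewrite response_expR // !normrM normr_sg y0 mul1r.
by rewrite [X in _ * X]gtr0_norm ?expR_gt0.
Qed.

(** An output sequence is a run as soon as the residuals that it leaves are
    admissible: the residuals themselves are taken as the disturbance.  The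
    adversary can thus fix the outputs first and the parameter last. *)
Lemma realize_trajectory (R : realType) (W : R) (mu : feedback_law R)
    (p : R * R) (y : nat -> R) :
  (forall t, `|y t.+1 - response p (y t) - mu t [tuple y i | i < t.+1]| <= W) ->
  exists2 w : nat -> R, admissible_disturbance W w &
    forall t, trajectory mu p (y 0%N) w t = y t.
Proof.
move=> hy.
pose w t := y t.-1.+1 - response p (y t.-1) - mu t.-1 [tuple y i | i < t.-1.+1].
exists w => [[|t] //= _|t]; first exact: hy.
have [n] := ubnP t; elim: n t => // n IH [|t] tn; first by rewrite trajectory0.
rewrite trajectoryS IH //.
have -> : [tuple trajectory mu p (y 0%N) w i | i < t.+1] = [tuple y i | i < t.+1].
  by apply: eq_from_tnth => i; rewrite !tnth_mktuple IH // (leq_trans (ltn_ord i)).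
by rewrite /w /= -/(response p (y t)); ring.
Qed.

(** Recursion in which each value depends on the whole past, presented to the
    step function as a sequence padded with [x0] beyond the present. *)
Lemma history_recursion (S : Type) (x0 : S) (step : nat -> (nat -> S) -> S) :
  exists y : nat -> S, y 0%N = x0 /\
    forall n, y n.+1 = step n (fun i => if (i <= n)%N then y i else x0).
Proof.
pose fix pref n : seq S := match n with
  | 0 => [:: x0] | m.+1 => rcons (pref m) (step m (nth x0 (pref m))) end.
have size_pref n : size (pref n) = n.+1.
  by elim: n => //= n IH; rewrite size_rcons IH.
have nth_pref n m : (n <= m)%N -> nth x0 (pref m) n = nth x0 (pref n) n.
  elim: m => [|m IH]; first by rewrite leqn0 => /eqP ->.
  rewrite leq_eqVlt => /predU1P[->//|nm].
  by rewrite -(IH nm) /= nth_rcons size_pref nm.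
exists (fun n => nth x0 (pref n) n); split => // n.
rewrite /= nth_rcons size_pref ltnn eqxx; congr step; apply/funext => i.
case: (leqP i n) => [/nth_pref //|ni].
by rewrite nth_default // size_pref.
Qed.

Lemma sqrt3_sqr (R : realType) : (Num.sqrt 3 : R) ^+ 2 = 3.
Proof. by rewrite sqr_sqrtr. Qed.

Lemma sqrt3_bounds (R : realType) : 173 / 100 <= Num.sqrt 3 :> R /\ Num.sqrt 3 <= 26 / 15 :> R.
Proof.
have := sqrt3_sqr R; have := sqrtr_ge0 (3 : R); set r := Num.sqrt 3 => r0 r2.
split; nra.
Qed.

Lemma sqrt3_exp_linear (R : realType) n : n.+1%:R <= 2 * (Num.sqrt 3 : R) ^+ n.
Proof.
have [rl _] := sqrt3_bounds R.
elim: n => [|n IH]; first by rewrite expr0; lra.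
have rn : 1 <= (Num.sqrt 3 : R) ^+ n by apply: exprn_ege1; lra.
by rewrite exprS -[n.+2%:R]natr1; nra.
Qed.

Definition critical (R : realType) : R := 3 * Num.sqrt 3 / 2.

Lemma critical_bounds (R : realType) : 259 / 100 <= critical R <= 13 / 5.
Proof.
by have [? ?] := sqrt3_bounds R; rewrite /critical; apply/andP; split; lra.
Qed.

(** [s^3 - beta s^2 + beta = (s - sqrt 3)^2 (s + sqrt 3 / 2)]: the double root of
    the critical characteristic polynomial. *)
Lemma critical_cubic (R : realType) (s : R) : 0 <= s ->
  critical R * (s ^+ 2 - 1) <= s ^+ 3.
Proof.
move=> s0; have := sqrt3_sqr R; have := sqrtr_ge0 (3 : R); rewrite /critical.
set r := Num.sqrt 3 => r0 r2.
have : 0 <= (s - r) ^+ 2 * (s + r / 2) by rewrite mulr_ge0 ?sqr_ge0 // addr_ge0 // divr_ge0.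
rewrite (_ : _ * (s + _) = s ^+ 3 - 3 * r / 2 * s ^+ 2 + r ^+ 2 * r / 2); last by field.
by rewrite r2; lra.
Qed.

(** * The adversary *)

(** Outputs before time [0] are replaced by the value [x0].  With [x0 = 1] for
    outputs, hence [0] for their logarithms, the first two moves of the adversary
    need no separate treatment. *)
Definition lag (R : Type) (x0 : R) (x : nat -> R) (t j : nat) : R :=
  if (j <= t)%N then x (t - j)%N else x0.

(** If the last two ratios are at least [sqrt 3], then [x_{t-2} <= x_t / 3] and
    the recursion gives [x_{t+1} >= (2 / 3) beta x_t - C (t + 1)].  The factor
    exceeds [sqrt 3] above the critical exponent, and the linear loss is
    absorbed by [x_t >= x_0 sqrt 3 ^ t] once [x_0] is large. *)
Lemma lacunary_growth (R : realType) (beta C : R) (x : nat -> R) :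
  let r := Num.sqrt 3 : R in
  0 < 2 / 3 * beta - r -> 0 <= C ->
  1 <= x 0%N -> 2 * C <= (2 / 3 * beta - r) * x 0%N ->
  (forall t, (forall i, (i <= t)%N -> r * lag 0 x i 1 <= x i /\ 1 <= x i) ->
     beta * (x t - lag 0 x t 2) - C * t.+1%:R <= x t.+1) ->
  forall t, r * lag 0 x t 1 <= x t /\ x 0%N * r ^+ t <= x t.
Proof.
move=> r eps0 C0 x0 x0C hx.
have [rl ru] := sqrt3_bounds R; have r2 := sqrt3_sqr R; rewrite -/r in rl ru r2.
have r_ge1 n : 1 <= r ^+ n by apply: exprn_ege1; lra.
have r_lin n : n.+1%:R <= 2 * r ^+ n by exact: sqrt3_exp_linear.
move=> t; have [n] := ubnP t; elim: n t => // n IH [|t] tn.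
  by rewrite /lag /= expr0 mulr1 mulr0; split; lra.
have IHt i : (i <= t)%N -> r * lag 0 x i 1 <= x i /\ x 0%N * r ^+ i <= x i.
  by move=> it; apply: IH; apply: leq_ltn_trans it _.
have ht := hx t (fun i it => conj (IHt i it).1 (le_trans x0
  (le_trans (ler_peMr (le_trans ler01 x0) (r_ge1 i)) (IHt i it).2))).
have [h1 h2] := IHt t (leqnn t).
have hlag : 3 * lag 0 x t 2 <= x t.
  apply: le_trans h1; rewrite -r2 expr2 -mulrA ler_wpM2l //; first lra.
  rewrite /lag; case: (t) IHt => [|[|s]] IHt //=; first by rewrite mulr0.
    by rewrite mulr0; have := (IHt 0%N isT).2; rewrite expr0; lra.
  rewrite subn2 subn1 /=; have := (IHt s.+1 (leqnSn _)).1.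
  by rewrite /lag /= subn1.
have hs : r * x t <= x t.+1.
  apply: le_trans ht.
  have := r_lin t; have := r_ge1 t; move: h2 => h2 rt1 rtl.
  have : C * t.+1%:R <= (2 / 3 * beta - r) * x t.
    apply: (@le_trans _ _ (C * (2 * r ^+ t))); first exact: ler_wpM2l.
    apply: (@le_trans _ _ ((2 / 3 * beta - r) * (x 0%N * r ^+ t))).
      by rewrite !mulrA; apply: ler_wpM2r; [lra|rewrite [C * 2]mulrC].
    by apply: ler_wpM2l => //; lra.
  nra.
split; first by rewrite /lag /= subn1.
by rewrite exprS; nra.
Qed.

(** The parameters at the disposal of the adversary: a decrease [q.1] of the
    log-gain, which keeps the sign of the gain, and an increase [q.2] of the
    exponent. *)
Definition shifted (R : realType) (p q : R * R) : R * R :=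
  (p.1 * expR (- q.1), p.2 + q.2).

(** The factor [1 + log |y_{t-1}|] keeps the change of the log-gain below
    [kappa / 2^t], and the response at [y_{t-2}] keeps the change of all older
    responses below [kappa / 2^t]. *)
Definition tilt_rate (R : realType) (kappa : R) (p q : R * R) (y : nat -> R)
    (t : nat) : R :=
  kappa / 2 ^+ t /
  ((1 + ln `|lag 1 y t 1|) * (1 + `|response (shifted p q) (lag 1 y t 2)|)).

(** Raising the exponent by [h] while lowering the log-gain by
    [h * log |y_{t-1}|] leaves the response at [y_{t-1}] unchanged. *)
Definition tilted (R : realType) (kappa : R) (p q : R * R) (y : nat -> R)
    (t : nat) : R * R :=
  let h := tilt_rate kappa p q y t in (q.1 + h * ln `|lag 1 y t 1|, q.2 + h).

Lemma ln_lag (R : realType) (y : nat -> R) t j :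
  ln `|lag 1 y t j| = lag 0 (fun i => ln `|y i|) t j.
Proof. by rewrite /lag; case: ifP => // _; rewrite normr1 ln1. Qed.

Lemma response_tilt (R : realType) (p : R * R) (h X y : R) : y != 0 ->
  response (p.1 * expR (- (h * X)), p.2 + h) y =
  response p y * expR (h * (ln `|y| - X)).
Proof.
move=> y0; rewrite !response_expR //= mulrDl.
rewrite [h * (_ - _)]mulrBr !expRD; ring.
Qed.

Lemma shifted_tilted (R : realType) (kappa : R) (p q : R * R) y t :
  shifted p (tilted kappa p q y t) =
  ((shifted p q).1 * expR (- (tilt_rate kappa p q y t * ln `|lag 1 y t 1|)),
   (shifted p q).2 + tilt_rate kappa p q y t).
Proof. by rewrite /shifted /tilted /= opprD expRD mulrA addrA. Qed.

(** Two candidate responses that differ by [2 L] cannot both be brought within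
    less than [L] of zero by the same input. *)
Lemma half_gap_le (R : realType) (u v v' : R) : `|v + u| <= `|v' + u| ->
  `|v' - v| / 2 <= `|v' + u|.
Proof.
move=> h; rewrite ler_pdivrMr ?ltr0n // mulr_natr mulr2n.
have -> : v' - v = (v' + u) - (v + u) by ring.
by apply: le_trans (ler_normB _ _) _; rewrite lerD2l.
Qed.

(** Each output is undisturbed with respect to the parameter chosen at that
    moment; disturbances enter only through the later changes of the parameter,
    which is fixed once the whole output sequence is known. *)
Lemma adversary_play (R : realType) (mu : feedback_law R) (kappa : R) (p : R * R)
    (y0 : R) :
  exists (y : nat -> R) (q : nat -> R * R), [/\ y 0%N = y0, q 0%N = (0, 0) &
    forall t,
    [/\ y t.+1 = response (shifted p (q t.+1)) (y t) + mu t [tuple y i | i < t.+1],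
      q t.+1 = q t \/ q t.+1 = tilted kappa p (q t) y t &
      `|response (shifted p (tilted kappa p (q t) y t)) (y t)
        - response (shifted p (q t)) (y t)| / 2 <= `|y t.+1|]].
Proof.
pose step t (z : nat -> R * (R * R)) :=
  let u := mu t [tuple (z i).1 | i < t.+1] in
  let v := response (shifted p (z t).2) (z t).1 + u in
  let q' := tilted kappa p (z t).2 (fun i => (z i).1) t in
  let v' := response (shifted p q') (z t).1 + u in
  if `|v| <= `|v'| then (v', q') else (v, (z t).2).
have [z [z0 zS]] := history_recursion (y0, (0, 0)) step.
exists (fun t => (z t).1), (fun t => (z t).2); split; rewrite ?z0 // => t.
have tupE : [tuple ((if (i <= t)%N then z i else (y0, (0, 0))).1) | i < t.+1]
    = [tuple (z i).1 | i < t.+1].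
  by apply: eq_from_tnth => i; rewrite !tnth_mktuple -ltnS ltn_ord.
have tiltE : tilted kappa p (z t).2
    (fun i => (if (i <= t)%N then z i else (y0, (0, 0))).1) t
    = tilted kappa p (z t).2 (fun i => (z i).1) t.
  by rewrite /tilted /tilt_rate /lag !leq_subr.
rewrite zS /step leqnn tupE tiltE; case: ifPn => [h|].
  by split => //=; [right|exact: half_gap_le].
rewrite -ltNge => /ltW h; split => //=; first by left.
by rewrite distrC; exact: half_gap_le.
Qed.

Lemma tilt_rate_bounds (R : realType) (kappa : R) (p q : R * R) y t :
  let h := tilt_rate kappa p q y t in
  let X := ln `|lag 1 y t 1| in
  0 < kappa -> 0 <= X ->
  [/\ 0 < h, h <= kappa / 2 ^+ t, h * X <= kappa / 2 ^+ t &
     h * X * `|response (shifted p q) (lag 1 y t 2)| <= kappa / 2 ^+ t].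
Proof.
move=> h X k0 X0; rewrite /h /tilt_rate -/X.
set N := `|response _ _|; set k := kappa / _.
have N0 : 0 <= N by exact: normr_ge0.
have kt0 : 0 < k by rewrite divr_gt0 ?exprn_gt0.
set D := (1 + X) * (1 + N).
have D1 : 1 <= D by rewrite /D; nra.
have hD : k / D * D = k by rewrite mulfVK //; lra.
have h0 : 0 < k / D by rewrite divr_gt0 //; lra.
move: h0 hD; set z := k / D => h0 hD.
split => //; rewrite -hD.
- by rewrite ler_peMr // ltW.
- by rewrite ler_wpM2l ?ltW // /D; nra.
- by rewrite -mulrA ler_wpM2l ?ltW // /D; nra.
Qed.

Lemma tilt_moves_past (R : realType) (p : R * R) (h X y : R) : y != 0 ->
  0 <= h -> 0 <= ln `|y| <= X ->
  `|response (p.1 * expR (- (h * X)), p.2 + h) y - response p y|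
    <= `|response p y| * (h * X).
Proof.
move=> y0 h0 /andP[y1 yX]; rewrite response_tilt //.
rewrite -{2}[response p y]mulr1 -mulrBr normrM ler_wpM2l //.
have := expR_ge1Dx (h * (ln `|y| - X)).
have : expR (h * (ln `|y| - X)) <= 1 by rewrite -expR0 ler_expR; nra.
by rewrite ler_norml => ? ?; apply/andP; split; nra.
Qed.

(** The convexity bound [exp z >= 1 + z] at [z = h (log |y| - X)]. *)
Lemma tilt_moves_present (R : realType) (p : R * R) (h X y : R) : y != 0 ->
  0 <= h -> X <= ln `|y| ->
  `|p.1| * expR (p.2 * ln `|y|) * (h * (ln `|y| - X)) <=
  `|response (p.1 * expR (- (h * X)), p.2 + h) y - response p y|.
Proof.
move=> y0 h0 yX; rewrite response_tilt //.
rewrite -{2}[response p y]mulr1 -mulrBr normrM norm_response //; apply: ler_wpM2l.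
  by rewrite mulr_ge0 ?expR_ge0.
apply: le_trans (ler_norm _).
by have := expR_ge1Dx (h * (ln `|y| - X)); lra.
Qed.

(** The tilt moves the response at [y_t] by about
    [|a| |y_t|^b h (x_t - x_{t-1})].  Dividing by the response at [y_{t-2}] that
    enters the rate [h] leaves [exp (b (x_t - x_{t-2}))], and the condition
    [sqrt 3 x_{t-1} <= x_t] keeps [(x_t - x_{t-1}) / (1 + x_{t-1})] above
    [1 / 5]. *)
Lemma tilt_swing (R : realType) (kappa : R) (p q : R * R) y t :
  let x := ln `|y t| in
  let X1 := ln `|lag 1 y t 1| in
  let X2 := ln `|lag 1 y t 2| in
  0 < kappa -> y t != 0 -> lag 1 y t 2 != 0 ->
  0 <= X1 -> 0 <= X2 -> 1 <= x -> Num.sqrt 3 * X1 <= x -> X2 <= x ->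
  0 <= p.2 -> 0 <= q.1 <= 2 * kappa -> 0 <= q.2 ->
  kappa * (`|p.1| * expR (- (2 * kappa)) / (1 + `|p.1|) / 5) / 2 ^+ t
     * expR (p.2 * (x - X2)) <=
  `|response (shifted p (tilted kappa p q y t)) (y t)
     - response (shifted p q) (y t)|.
Proof.
move=> x X1 X2 k0 yt y2 X10 X20 x1 X1x X2x p0 /andP[q0 qk] q20.
have [s3l s3u] := sqrt3_bounds R.
have X1x' : 17 / 10 * X1 <= x by nra.
have [h0 _ _ _] := @tilt_rate_bounds _ _ p q y t k0 X10.
rewrite shifted_tilted.
apply: le_trans (tilt_moves_present (shifted p q) yt (ltW h0) _); last by rewrite -/x -/X1; nra.
rewrite /tilt_rate -/X1 -/x norm_response // -/X2 /shifted /=.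
rewrite normrM [`|expR _|]gtr0_norm ?expR_gt0 //.
set A0 := `|p.1|; set A := A0 * expR (- q.1).
set B := p.2 + q.2; set k := kappa / 2 ^+ t.
have A00 : 0 <= A0 by exact: normr_ge0.
have A1 : A <= A0.
  by rewrite /A ler_piMr // -[leRHS]expR0 ler_expR; lra.
have A2 : A0 * expR (- (2 * kappa)) <= A.
  by rewrite /A ler_wpM2l // ler_expR; lra.
have A3 : 0 <= A by rewrite /A mulr_ge0 ?expR_ge0.
have E2 : 1 <= expR (B * X2).
  by rewrite -[leLHS]expR0 ler_expR /B; nra.
have kt0 : 0 < k by rewrite divr_gt0 ?exprn_gt0.
have Ex : expR (p.2 * (x - X2)) * expR (B * X2) <= expR (B * x).
  by rewrite -expRD ler_expR /B; nra.
set E := expR (p.2 * _) in Ex *; set F := expR (B * X2) in E2 Ex *.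
have E0 : 0 <= E by exact: expR_ge0.
rewrite (_ : kappa * _ / _ = k * (A0 * expR (- (2 * kappa)) / (1 + A0)) / 5);
  last by rewrite /k; field; rewrite gt_eqF ?exprn_gt0 //=; lra.
rewrite (_ : _ * _ * (_ / _ * (_ - _)) =
    (A * expR (B * x) / (1 + A * F)) * (k * (x - X1) / (1 + X1))); last first.
  by field; rewrite !gt_eqF //; nra.
apply: (@le_trans _ _ ((A0 * expR (- (2 * kappa)) / (1 + A0) * E) * (k / 5))).
  by rewrite le_eqVlt; apply/orP; left; apply/eqP; field; lra.
apply: ler_pM.
- by rewrite mulr_ge0 ?divr_ge0 ?mulr_ge0 ?expR_ge0 //; lra.
- by rewrite divr_ge0 //; lra.
- rewrite ler_pdivlMr; last nra.
  apply: le_trans (_ : A * (E * F) <= _); last by rewrite ler_wpM2l.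
  set m := _ * expR _ in A2 *.
  have m0 : 0 <= m by rewrite mulr_ge0 ?expR_ge0.
  have hm : m * (1 + A * F) <= A * F * (1 + A0).
    rewrite -[leRHS]mulrA; apply: ler_pM => //; first nra.
    nra.
  rewrite (_ : m / _ * E * _ = E * (m * (1 + A * F)) / (1 + A0)); last by field; lra.
  rewrite ler_pdivrMr; last lra.
  by apply: le_trans (ler_wpM2l E0 hm) _; rewrite le_eqVlt; apply/orP; left; apply/eqP; ring.
- rewrite -[leRHS]mulrA; apply: ler_wpM2l; [exact: ltW|rewrite ler_pdivlMr]; last lra.
  lra.
Qed.

Lemma cvg_response_shifted (R : realType) (p : R * R) (q : nat -> R * R)
    (g k y : R) : y != 0 ->
  (fun n => (q n).1) @ \oo --> g -> (fun n => (q n).2) @ \oo --> k ->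
  (fun n => response (shifted p (q n)) y) @ \oo --> response (shifted p (g, k)) y.
Proof.
move=> y0 hg hk; rewrite response_expR //.
rewrite (_ : (fun n => _) = fun n => Num.sg y *
   (p.1 * expR (- (q n).1) * expR ((p.2 + (q n).2) * ln `|y|))); last first.
  by apply/funext => n; rewrite response_expR.
apply: cvgMr; apply: cvgM => /=.
  apply: cvgMr; apply: (@cvg_comp _ _ _ (fun n => - (q n).1) expR _ _ _ _ (@continuous_expR R _)).
  exact: cvgN.
apply: (@cvg_comp _ _ _ (fun n => (p.2 + (q n).2) * ln `|y|) expR _ _ _ _ (@continuous_expR R _)).
by apply: cvgMl; apply: cvgD => //; exact: cvg_cst.
Qed.

Lemma limit_in_ball (R : realType) (u : nat -> R) (l a r : R) (N : nat) :
  u @ \oo --> l -> (forall n, (N <= n)%N -> `|u n - a| <= r) -> `|l - a| <= r.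
Proof.
move=> hu hN.
have hc : (fun n => `|u n - a|) @ \oo --> `|l - a|.
  by apply: cvg_norm; apply: cvgB => //; exact: cvg_cst.
by apply: (cvgr_to_le hc); near=> n; apply: hN; near: n; exact: nbhs_infty_ge.
Unshelve. all: by end_near.
Qed.

Lemma nondecreasing_limit (R : realType) (u : nat -> R) (M : R) :
  (forall n, u n <= u n.+1) -> (forall n, u n <= M) ->
  exists2 l : R, u @ \oo --> l & u 0%N <= l <= M.
Proof.
move=> umon uM; have cu : cvgn u.
  apply: nondecreasing_is_cvgn; first exact/nondecreasing_seqP.
  by exists M => _ [n _ <-].
exists (limn u) => //; apply/andP; split.
  apply: limr_ge => //; near=> n.
  by apply: (proj1 (nondecreasing_seqP u)).
by apply: limr_le => //; near=> n.
Unshelve. all: by end_near.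
Qed.

Lemma dyadic_telescope (R : realType) (u : nat -> R) (kappa : R) (N : nat) :
  (forall n, (N <= n)%N -> `|u n.+1 - u n| <= kappa / 2 ^+ n) ->
  forall n, (N <= n)%N -> `|u n - u N| <= 2 * kappa / 2 ^+ N - 2 * kappa / 2 ^+ n.
Proof.
move=> hu; elim=> [|n IH].
  by rewrite leqn0 => /eqP <-; rewrite !subrr normr0.
rewrite leq_eqVlt => /predU1P[<-|]; first by rewrite !subrr normr0.
rewrite ltnS => Nn.
have -> : u n.+1 - u N = (u n.+1 - u n) + (u n - u N) by ring.
apply: le_trans (ler_normD _ _) _; apply: le_trans (lerD (hu n Nn) (IH Nn)) _.
rewrite exprS le_eqVlt; apply/orP; left; apply/eqP; field.
by rewrite !gt_eqF ?exprn_gt0.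
Qed.

Section Play.
Variables (R : realType) (kappa : R) (p : R * R) (y : nat -> R) (q : nat -> R * R).
Hypotheses (k0 : 0 < kappa) (q0 : q 0%N = (0, 0)).
Hypothesis hq : forall t, q t.+1 = q t \/ q t.+1 = tilted kappa p (q t) y t.

Lemma lag1_ge0 t : (forall i, (i < t)%N -> 0 <= ln `|y i|) ->
  forall i j, (i <= t)%N -> (0 < j)%N -> 0 <= ln `|lag 1 y i j|.
Proof.
move=> hy i j it j0; rewrite /lag; case: ifP => ji; last by rewrite normr1 ln1.
by apply: hy; rewrite (leq_trans _ it) // ltn_subrL j0 (leq_trans j0 ji).
Qed.

Lemma play_step t : 0 <= ln `|lag 1 y t 1| ->
  (q t).1 <= (q t.+1).1 <= (q t).1 + kappa / 2 ^+ t /\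
  (q t).2 <= (q t.+1).2 <= (q t).2 + kappa / 2 ^+ t.
Proof.
move=> hX; have [h0 h1 h2 _] := @tilt_rate_bounds _ _ p (q t) y t k0 hX.
have kt : 0 <= kappa / 2 ^+ t by rewrite divr_ge0 ?exprn_ge0 ?ltW.
have hX0 : 0 <= tilt_rate kappa p (q t) y t * ln `|lag 1 y t 1|.
  by rewrite mulr_ge0 // ltW.
case: (hq t) => ->; first by split; apply/andP; split; lra.
by rewrite /tilted /=; split; apply/andP; split; lra.
Qed.

Lemma play_range t : (forall i, (i < t)%N -> 0 <= ln `|y i|) ->
  0 <= (q t).1 <= 2 * kappa /\ 0 <= (q t).2 <= 2 * kappa.
Proof.
move=> hy.
suff : forall n, (n <= t)%N ->
    0 <= (q n).1 <= 2 * kappa - 2 * kappa / 2 ^+ n /\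
    0 <= (q n).2 <= 2 * kappa - 2 * kappa / 2 ^+ n.
  move=> /(_ t (leqnn t)) [/andP[a b] /andP[c d]].
  have : 0 <= 2 * kappa / 2 ^+ t by rewrite divr_ge0 ?exprn_ge0 ?mulr_ge0 ?ltW.
  by move=> z; split; apply/andP; split; lra.
elim=> [|n IH] nt; first by rewrite q0 /= expr0; split; apply/andP; split; lra.
have [/andP[a b] /andP[c d]] := IH (ltnW nt).
have hX := lag1_ge0 hy (ltnW nt) (isT : (0 < 1)%N).
have [/andP[a' b'] /andP[c' d']] := play_step hX.
have -> : 2 * kappa / 2 ^+ n.+1 = 2 * kappa / 2 ^+ n - kappa / 2 ^+ n.
  by rewrite exprS; field; rewrite gt_eqF ?exprn_gt0.
by split; apply/andP; split; lra.
Qed.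

(** The tilt fixes the response at [y_{t-1}]; at an older output it changes it by
    at most the response at [y_{t-2}] times [h * log |y_{t-1}|], which the choice
    of the rate makes at most [kappa / 2^t]. *)
Lemma play_past t i : (forall j, 1 <= ln `|y j|) ->
  (forall j, ln `|y j| <= ln `|y j.+1|) -> 0 <= p.2 ->
  (i < t)%N ->
  `|response (shifted p (q t.+1)) (y i) - response (shifted p (q t)) (y i)|
    <= kappa / 2 ^+ t.
Proof.
move=> y1 ymon p0 it.
have y_neq0 j : y j != 0.
  by apply: contraTneq (y1 j) => ->; rewrite normr0 ln0 // -ltNge; lra.
have kt : 0 <= kappa / 2 ^+ t by rewrite divr_ge0 ?exprn_ge0 ?ltW.
case: (hq t) => ->; first by rewrite subrr normr0.
have hX j : 0 <= ln `|lag 1 y t j|.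
  by rewrite /lag; case: ifP => _; rewrite ?normr1 ?ln1 //; apply: le_trans (y1 _).
have [h0 _ _ h3] := @tilt_rate_bounds _ _ p (q t) y t k0 (hX 1%N).
have y_mon j k : (j <= k)%N -> ln `|y j| <= ln `|y k|.
  by move: j k; apply/(@nondecreasing_seqP _ _ (fun j => ln `|y j|)).
have hB : 0 <= p.2 + (q t).2.
  have [_ /andP[? _]] : 0 <= (q t).1 <= 2 * kappa /\ 0 <= (q t).2 <= 2 * kappa.
    by apply: play_range => j _; apply: le_trans (y1 _).
  lra.
move: h3; rewrite shifted_tilted; set h := tilt_rate _ _ _ _ _ in h0 *.
move: (hX 1%N) (hX 2%N).
rewrite /lag (leq_ltn_trans (leq0n i) it).
have [->|ti] := eqVneq i (t - 1)%N.
  by move=> ? ? _; rewrite response_tilt // subrr mulr0 expR0 mulr1 subrr normr0.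
have it2 : (i <= t - 2)%N.
  move: it ti; case: (t) => [|[|s]] //; rewrite ?subn1 ?subn2 /= ltnS leq_eqVlt.
  by move=> /predU1P[->|//]; rewrite ?eqxx.
have t2 : (2 <= t)%N by case: (t) it ti => [|[|s]] //; case: (i) => // ; rewrite subn1.
rewrite t2 => X1 X2 h3.
apply: le_trans (tilt_moves_past (shifted p (q t)) (y_neq0 i) (ltW h0) _) _.
  by rewrite (le_trans _ (y1 i)) // y_mon // (leq_trans it2) // leq_sub2l.
rewrite mulrC; apply: le_trans h3; apply: ler_wpM2l; first by rewrite mulr_ge0 // ltW.
rewrite !norm_response //; apply: ler_wpM2l => //.
by rewrite ler_expR; apply: ler_wpM2l => //; exact: y_mon.
Qed.

End Play.

(** The parameters chosen during the play converge monotonically, and the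
    response at [y_t] moves by at most [kappa] in total after time [t], so the
    limit parameter explains all outputs with disturbances bounded by [W].  The
    growth is that of [lacunary_growth] for [x_t = log |y_t|]. *)
Theorem adversary_forces_growth (R : realType) (mu : feedback_law R)
    (W kappa R0 : R) (p : R * R) :
  0 < kappa <= W -> p.1 != 0 -> 0 < 2 / 3 * p.2 - Num.sqrt 3 ->
  exists (q : R * R) (y0 c : R) (w : nat -> R),
    [/\ 0 <= q.1 <= 2 * kappa, 0 <= q.2 <= 2 * kappa, R0 <= y0,
        admissible_disturbance W w & 0 < c] /\
    forall t, c * Num.sqrt 3 ^+ t <= ln `|trajectory mu (shifted p q) y0 w t|.
Proof.
move=> /andP[k0 kW] p10 eps0.
set eps := _ - _ in eps0.
have [s3l s3u] := sqrt3_bounds R.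
have p20 : 0 <= p.2 by move: eps0; rewrite /eps; lra.
set K := kappa * (`|p.1| * expR (- (2 * kappa)) / (1 + `|p.1|) / 5) / 2.
have p1p : 0 < `|p.1| by rewrite normr_gt0.
have K0 : 0 < K by rewrite !(mulr_gt0, invr_gt0, expR_gt0) //; lra.
(* [expR (- C)] is below both [K] and [1 / 2], hence [expR (- C (t + 1))] is below
   [K / 2 ^ t]. *)
pose C := 1 + `|ln K|.
have C1 : 1 <= C by rewrite /C lerDl.
have CK : expR (- C) <= K.
  rewrite -[leRHS](lnK (x := K)) // ler_expR /C.
  have := ler_norm (- ln K); rewrite normrN; lra.
have C2 : expR (- C) <= 2^-1.
  rewrite expRN lef_pV2 ?posrE ?expR_gt0 //.
  by have := expR_ge1Dx C; lra.
have hC t : expR (- (C * t.+1%:R)) <= K / 2 ^+ t.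
  rewrite -mulNr mulrC -natr1 mulrDl mul1r expRD expRM_natl mulrC.
  rewrite -exprVn; apply: ler_pM => //; rewrite ?expR_ge0 ?exprn_ge0 ?expR_ge0 //.
  by rewrite lerXn2r ?nnegrE ?expR_ge0 ?invr_ge0.
clearbody C; clear CK C2.
(* Large enough for the linear loss in [lacunary_growth] to be absorbed. *)
pose x0 := 1 + `|R0| + 2 * C / eps.
have x0C : 2 * C <= eps * x0.
  rewrite /x0 mulrDr [eps * (_ / eps)]mulrC divfK ?gt_eqF // lerDr.
  by apply: mulr_ge0; [exact: ltW|exact: addr_ge0].
have x01 : 1 <= x0.
  by rewrite /x0 -addrA lerDl addr_ge0 // divr_ge0 ?ltW //; lra.
have x0R : R0 <= expR x0.
  apply: le_trans (expR_ge1Dx _).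
  have := ler_norm R0; have : 0 <= 2 * C / eps by rewrite divr_ge0 ?ltW //; lra.
  by rewrite /x0; lra.
have [y [q [y0E q0 hyq]]] := adversary_play mu kappa p (expR x0).
have hq t : q t.+1 = q t \/ q t.+1 = tilted kappa p (q t) y t by case: (hyq t).
have xE : ln `|y 0%N| = x0 by rewrite y0E gtr0_norm ?expR_gt0 // expRK.
have grow := @lacunary_growth R p.2 C (fun i => ln `|y i|) eps0 (le_trans ler01 C1).
rewrite /= xE in grow.
have {grow} grow : forall t, Num.sqrt 3 * lag 0 (fun i => ln `|y i|) t 1 <= ln `|y t|
    /\ x0 * Num.sqrt 3 ^+ t <= ln `|y t|.
  apply: grow => // t ht.
  have y1 i : (i <= t)%N -> 1 <= ln `|y i| by move=> /ht[].
  have y_neq0 i : (i <= t)%N -> y i != 0.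
    by move=> /y1; apply: contraTneq => ->; rewrite normr0 ln0 // -ltNge; lra.
  have y_ge0 i : (i < t)%N -> 0 <= ln `|y i| by move=> /ltnW /y1; lra.
  have [qr1 /andP[qr2 _]] := play_range k0 q0 hq y_ge0.
  have X1 := lag1_ge0 y_ge0 (leqnn t) (isT : (0 < 1)%N).
  have X2 := lag1_ge0 y_ge0 (leqnn t) (isT : (0 < 2)%N).
  have y2 : lag 1 y t 2 != 0.
    by rewrite /lag; case: ifP => _; rewrite ?oner_neq0 // y_neq0 // leq_subr.
  have h1 : Num.sqrt 3 * ln `|lag 1 y t 1| <= ln `|y t|.
    by rewrite ln_lag; case: (ht t (leqnn t)).
  have dil (a b : R) : 1 <= a -> Num.sqrt 3 * a <= b -> a <= b by move=> ? ?; nra.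
  have h2 : ln `|lag 1 y t 2| <= ln `|y t|.
    rewrite ln_lag; have := (ht _ (leqnn t)).1; have := y1 _ (leqnn t).
    rewrite /lag; case: (t) ht y1 => [|[|s]] ht y1 //=; try lra.
    rewrite subn1 subn2 /= => _ h; apply: (le_trans _ (dil _ _ _ h)); last exact: y1.
    have := (ht s.+1 (leqnSn _)).1; rewrite /lag /= subn1 /=; apply: dil.
    by apply: y1; exact: leq_trans (leqnSn _) _.
  have := tilt_swing k0 (y_neq0 _ (leqnn t)) y2 X1 X2 (y1 _ (leqnn t)) h1 h2 p20 qr1 qr2.
  have [_ _ hgap] := hyq t.
  rewrite ln_lag; set x2 := lag 0 _ t 2 => sw.
  have : K / 2 ^+ t * expR (p.2 * (ln `|y t| - x2)) <= `|y t.+1|.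
    apply: le_trans hgap; rewrite ler_pdivlMr //.
    apply: le_trans sw; rewrite le_eqVlt; apply/orP; left; apply/eqP.
    rewrite /K; field; rewrite !gt_eqF ?exprn_gt0 //=; lra.
  move=> hy; have {hy} : expR (p.2 * (ln `|y t| - x2) - C * t.+1%:R) <= `|y t.+1|.
    apply: le_trans hy; rewrite expRD mulrC; apply: ler_wpM2r => //.
  move=> hy; rewrite -[leLHS]expRK ler_ln // posrE ?expR_gt0 //.
  by apply: lt_le_trans hy; exact: expR_gt0.
have y1 t : 1 <= ln `|y t|.
  apply: le_trans (grow t).2; rewrite -[leLHS]mulr1; apply: ler_pM => //.
  by apply: exprn_ege1; lra.
have ymon t : ln `|y t| <= ln `|y t.+1|.
  have := (grow t.+1).1; rewrite /lag /= subn1 /=; have := y1 t; nra.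
have y_neq0 t : y t != 0.
  by apply: contraTneq (y1 t) => ->; rewrite normr0 ln0 // -ltNge; lra.
have hrange t : 0 <= (q t).1 <= 2 * kappa /\ 0 <= (q t).2 <= 2 * kappa.
  by apply: (play_range k0 q0 hq) => i _; apply: le_trans (y1 _).
have hmon t : (q t).1 <= (q t.+1).1 /\ (q t).2 <= (q t.+1).2.
  have [|/andP[? _] /andP[? _]] := @play_step _ _ p y q k0 hq t; last by [].
  by rewrite /lag; case: ifP => _; rewrite ?normr1 ?ln1 //; apply: le_trans (y1 _).
have [g hg] : exists2 g, (fun t => (q t).1) @ \oo --> g & (q 0%N).1 <= g <= 2 * kappa.
  apply: nondecreasing_limit => t; first exact: (hmon t).1.
  by case: (hrange t) => /andP[].
have [k hk] : exists2 k, (fun t => (q t).2) @ \oo --> k & (q 0%N).2 <= k <= 2 * kappa.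
  apply: nondecreasing_limit => t; first exact: (hmon t).2.
  by case: (hrange t) => _ /andP[].
rewrite q0 /= => kr gr.
have [|w hw htraj] := @realize_trajectory R W mu (shifted p (g, k)) y.
  move=> t; have [-> _ _] := hyq t.
  rewrite (_ : _ - _ - _ =
    response (shifted p (q t.+1)) (y t) - response (shifted p (g, k)) (y t)); last by ring.
  rewrite distrC; apply: (limit_in_ball (N := t.+1)
    (@cvg_response_shifted R p q g k (y t) (y_neq0 t) hg hk)).
  move=> n tn.
  have past m : (t < m)%N -> `|response (shifted p (q m.+1)) (y t)
      - response (shifted p (q m)) (y t)| <= kappa / 2 ^+ m.
    by move=> tm; exact: (play_past k0 q0 hq).
  apply: le_trans (@dyadic_telescope R (fun n => response (shifted p (q n)) (y t)) _ _ past n tn) _.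
  apply: le_trans kW.
  have : 0 <= 2 * kappa / 2 ^+ n by rewrite divr_ge0 ?exprn_ge0 ?mulr_ge0 ?ltW.
  have : 2 * kappa / 2 ^+ t.+1 <= kappa.
    rewrite ler_pdivrMr ?exprn_gt0 // exprS [leRHS]mulrCA ler_wpM2l //.
    by apply: ler_peMr; [exact: ltW|apply: exprn_ege1; lra].
  lra.
exists (g, k), (y 0%N), x0, w; rewrite y0E; split; first by split => //; lra.
by move=> t; rewrite -y0E htraj; exact: (grow t).2.
Qed.

(** The base point is [p0] itself, except that a zero gain is first moved to a
    nonzero one, because the shifts act on the logarithm of the gain. *)
Lemma shifted_in_nbhs (R : realType) (W : R) (p0 : R * R) (Q : set (R * R)) :
  0 < W -> nbhs p0 Q ->
  exists (p : R * R) (kappa : R), [/\ p.1 != 0, p.2 = p0.2, 0 < kappa <= W &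
    forall q, 0 <= q.1 <= 2 * kappa -> 0 <= q.2 <= 2 * kappa -> Q (shifted p q)].
Proof.
move=> W0 /nbhs_ballP[e /= e0 eQ].
pose a := if p0.1 == 0 then e / 2 else p0.1.
have a0 : a != 0 by rewrite /a; case: (eqVneq p0.1 0) => [_|//]; rewrite gt_eqF // divr_gt0.
have ap : `|a - p0.1| <= e / 2.
  rewrite /a; case: eqVneq => [->|_]; last by rewrite subrr normr0 divr_ge0 ?ltW.
  by rewrite subr0 gtr0_norm // divr_gt0.
clearbody a.
pose k := Num.min W (e / (8 * (1 + `|a|))).
have an : 0 <= `|a| := normr_ge0 a.
have k0 : 0 < k by rewrite /k lt_min W0 divr_gt0 //; lra.
have ke : k * (8 * (1 + `|a|)) <= e.
  by rewrite -ler_pdivlMr; [rewrite /k ge_min lexx orbT|lra].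
exists (a, p0.2), k; split => //; first by rewrite k0 /k ge_min lexx.
move=> [g b] /= /andP[g0 gk] /andP[b0 bk]; apply: eQ; rewrite /shifted /=.
split; rewrite /ball /= /ball_ /=; last first.
  by rewrite opprD addNKr normrN ger0_norm //; nra.
have -> : p0.1 - a * expR (- g) = a * (1 - expR (- g)) - (a - p0.1) by ring.
apply: le_lt_trans (ler_normB _ _) _; rewrite normrM.
have := expR_ge1Dx (- g); have : expR (- g) <= 1 by rewrite -expR0 ler_expR; lra.
move=> h1 h2; rewrite [`|1 - _|]ger0_norm; last lra.
nra.
Qed.

Lemma double_exponential_unbounded (R : realType) (c : R) (y : nat -> R) : 0 < c ->
  (forall t, c * Num.sqrt 3 ^+ t <= ln `|y t|) ->
  ~ has_ubound (range (fun t => `|y t|)).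
Proof.
move=> c0 hy [M hM].
have yM t : ln `|y t| <= `|M|.
  have [yt|yt] := lerP `|y t| 0; first by rewrite ln0.
  have := hM _ (ex_intro2 _ _ t I erefl) => /= h.
  have := ln_sublinear yt; have := ler_norm M; lra.
have M0 : 0 <= 2 * `|M| / c by apply: divr_ge0; [exact: mulr_ge0|exact: ltW].
have := archi_boundP M0; set n := Num.bound _ => hn.
have := sqrt3_exp_linear R n; have := hy n; have := yM n.
move: hn; rewrite ltr_pdivrMr // -natr1; nra.
Qed.

Theorem impossibility (R : realType) (W : R) (p0 : R * R) (Q : set (R * R))
    (mu : feedback_law R) (R0 : R) :
  0 < W -> 3 * Num.sqrt 3 / 2 < p0.2 -> nbhs p0 Q ->
  exists (p : R * R) (y0 : R) (w : nat -> R) (c z : R) (T0 : nat),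
    [/\ Q p, R0 <= y0, admissible_disturbance W w, 0 < c & 1 < z] /\
    (forall t : nat, (T0 <= t)%N ->
       c * z ^+ t <= ln `|trajectory mu p y0 w t|) /\
    ~ has_ubound (range (fun t => `|trajectory mu p y0 w t|)).
Proof.
move=> W0 hb hQ; have [p [kappa [p1 p2 hk pQ]]] := shifted_in_nbhs W0 hQ.
have eps : 0 < 2 / 3 * p.2 - Num.sqrt 3 by rewrite p2; lra.
have [q [y0 [c [w [[q1 q2 Ry hw c0] hy]]]]] := adversary_forces_growth mu R0 hk p1 eps.
exists (shifted p q), y0, w, c, (Num.sqrt 3), 0%N; split.
  by split => //; [exact: pQ|have [] := sqrt3_bounds R; lra].
by split => //; exact: double_exponential_unbounded hy.
Qed.

(** * Prediction errors as gaps between two exponentials *)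

(** Up to sign, the difference of two responses as a function of the log-size of
    the output. *)
Definition exp_gap (R : realType) (p p' : R * R) (x : R) : R :=
  p.1 * expR (p.2 * x) - p'.1 * expR (p'.2 * x).

Section Gap.
Variables (R : realType) (p p' : R * R) (beta w : R).
Hypotheses (b0 : 0 <= p.2) (bb' : p.2 <= p'.2) (b'beta : p'.2 <= beta).

Let delta := p'.2 - p.2.
Let affine (x : R) := p.1 - p'.1 * expR (delta * x).

Lemma exp_gapE x : exp_gap p p' x = expR (p.2 * x) * affine x.
Proof.
rewrite /exp_gap /affine mulrBr mulrC [in RHS]mulrCA -expRD /delta.
by congr (_ - _ * expR _); ring.
Qed.

Lemma affine_bound x : `|exp_gap p p' x| <= w -> `|affine x| <= w * expR (- (p.2 * x)).
Proof.
rewrite exp_gapE normrM gtr0_norm ?expR_gt0 // => h.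
by rewrite expRN ler_pdivlMr ?expR_gt0 // mulrC.
Qed.

Lemma expR_delta_mono x y : x <= y -> expR (delta * x) <= expR (delta * y).
Proof. by move=> xy; rewrite ler_expR ler_wpM2l // /delta subr_ge0. Qed.

(** Divided by [expR (p.2 * x)], the gap is affine, hence monotone, in
    [expR ((p'.2 - p.2) * x)], so it lies between its values at both ends. *)
Lemma exp_gap_interp xs x xr : xs <= x <= xr ->
  `|exp_gap p p' xs| <= w -> `|exp_gap p p' xr| <= w ->
  `|exp_gap p p' x| <= w * expR (beta * (x - xs)).
Proof.
move=> /andP[sx xr_] hs hr.
have w0 : 0 <= w by apply: le_trans hs.
have {hs} hs := affine_bound hs; have {hr} hr := affine_bound hr.
have hr' : `|affine xr| <= w * expR (- (p.2 * xs)).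
  by apply: le_trans hr _; rewrite ler_wpM2l // ler_expR lerN2 ler_wpM2l //; lra.
have hx : `|affine x| <= w * expR (- (p.2 * xs)).
  move: hs hr'; rewrite /affine.
  have := expR_delta_mono sx; have := expR_delta_mono xr_.
  rewrite !ler_norml => ? ? /andP[? ?] /andP[? ?].
  by have [a0|a0] := lerP 0 p'.1; apply/andP; split; nra.
rewrite exp_gapE normrM gtr0_norm ?expR_gt0 //.
apply: (@le_trans _ _ (w * (expR (p.2 * x) * expR (- (p.2 * xs))))).
  by rewrite mulrCA ler_wpM2l ?expR_ge0.
by rewrite -expRD ler_wpM2l // ler_expR -mulrBr ler_wpM2r ?subr_ge0 //; exact: le_trans bb' b'beta.
Qed.

(** With [q = exp (- delta (xr - xs))] this is the Bernoulli inequality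
    [1 - q^n <= n (1 - q)]. *)
Lemma expR_delta_extrap n xs xr x : xs <= xr -> xr <= x ->
  x - xr <= n%:R * (xr - xs) ->
  expR (delta * x) - expR (delta * xr) <=
  n%:R * expR (delta * (x - xr)) * (expR (delta * xr) - expR (delta * xs)).
Proof.
move=> sr rx hn.
have d0 : 0 <= delta by rewrite /delta subr_ge0.
set q := expR (- (delta * (xr - xs))).
have q0 : 0 <= q by exact: expR_ge0.
have q1 : q <= 1 by rewrite /q -expR0 ler_expR; nra.
have -> : expR (delta * xr) - expR (delta * xs) = expR (delta * xr) * (1 - q).
  by rewrite mulrBr mulr1 /q -expRD; congr (_ - expR _); ring.
rewrite [X in _ <= X]mulrA -[_ * expR (delta * (x - xr)) * _]mulrA -expRD.
have -> : delta * (x - xr) + delta * xr = delta * x by ring.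
have -> : expR (delta * x) - expR (delta * xr) =
    expR (delta * x) * (1 - expR (- (delta * (x - xr)))).
  by rewrite mulrBr mulr1 -expRD; congr (_ - expR _); ring.
rewrite [n%:R * _]mulrC -mulrA ler_wpM2l ?expR_ge0 //.
have h1 : q ^+ n <= expR (- (delta * (x - xr))).
  by rewrite /q -expRM_natl ler_expR; nra.
apply: le_trans (_ : 1 - q ^+ n <= _); first lra.
elim: (n) => [|m IH]; first by rewrite expr0 subrr mul0r.
have qm : q ^+ m <= 1 by rewrite exprn_ile1.
have qm0 : 0 <= q ^+ m by rewrite exprn_ge0.
by rewrite exprS -natr1; nra.
Qed.

(** The affine function is extrapolated from [xs] and [xr]; its slope costs the
    factor [exp (delta (x - xr))] only, counted from the nearer point.  As
    [p.2 + delta <= beta], this saves [exp (- eta (xr - xs))] whenever [p.2] is at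
    most [beta - eta], however the competing exponent [p'.2] is placed. *)
Lemma exp_gap_extrap n eta xs xr x : xs <= xr -> xr <= x ->
  x - xr <= n%:R * (xr - xs) -> p.2 <= beta - eta ->
  `|exp_gap p p' xs| <= w -> `|exp_gap p p' xr| <= w ->
  `|exp_gap p p' x| <= (1 + 2 * n%:R) * w * expR (beta * (x - xs) - eta * (xr - xs)).
Proof.
move=> sr rx hn beta_eta hs hr.
have w0 : 0 <= w by apply: le_trans hs.
have d0 : 0 <= delta by rewrite /delta subr_ge0.
have {hs} hs := affine_bound hs; have {hr} hr := affine_bound hr.
set M := w * expR (- (p.2 * xs)) in hs.
have M0 : 0 <= M by rewrite mulr_ge0 ?expR_ge0.
have hr' : `|affine xr| <= M.
  by apply: le_trans hr _; rewrite ler_wpM2l // ler_expR lerN2 ler_wpM2l //; lra.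
have hE := expR_delta_extrap sr rx hn.
have ex1 : 1 <= expR (delta * (x - xr)) by rewrite -[leLHS]expR0 ler_expR; nra.
have n0 : 0 <= n%:R :> R by [].
have diff : `|affine x - affine xr| <= n%:R * expR (delta * (x - xr)) * (2 * M).
  have -> : affine x - affine xr = - p'.1 * (expR (delta * x) - expR (delta * xr)).
    by rewrite /affine; ring.
  rewrite normrM normrN [X in _ * X]ger0_norm ?subr_ge0 ?expR_delta_mono //.
  apply: le_trans (ler_wpM2l (normr_ge0 _) hE) _.
  rewrite mulrCA ler_wpM2l ?mulr_ge0 ?expR_ge0 //.
  rewrite -[X in _ * X]ger0_norm ?subr_ge0 ?expR_delta_mono // -normrM.
  rewrite (_ : p'.1 * _ = affine xs - affine xr); last by rewrite /affine; ring.
  by apply: le_trans (ler_normB _ _) _; lra.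
have hx : `|affine x| <= (1 + 2 * n%:R) * M * expR (delta * (x - xr)).
  have -> : affine x = affine xr + (affine x - affine xr) by ring.
  apply: le_trans (ler_normD _ _) _.
  move: diff hr'; move: `|_ - _| `|affine xr| => u v; nra.
rewrite exp_gapE normrM gtr0_norm ?expR_gt0 //.
apply: le_trans (ler_wpM2l (expR_ge0 _) hx) _.
rewrite /M [leLHS](_ : _ = (1 + 2 * n%:R) * w *
    (expR (p.2 * x) * expR (- (p.2 * xs)) * expR (delta * (x - xr)))); last by ring.
apply: ler_wpM2l; first by rewrite mulr_ge0 // addr_ge0 ?mulr_ge0.
rewrite -!expRD ler_expR /delta -subr_ge0.
rewrite (_ : _ - _ = (beta - p'.2) * (x - xr) + (beta - eta - p.2) * (xr - xs)); last by ring.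
by rewrite addr_ge0 // mulr_ge0 // subr_ge0.
Qed.

(** When the two exponents nearly agree, the gap at [x] is the gap at [xr] scaled
    by [exp (p.2 (x - xr))], up to an error that vanishes with [delta] on a
    bounded range. *)
Lemma exp_gap_single A H v xr x : 0 <= xr <= H -> 0 <= x <= H ->
  `|p'.1| <= A -> A * expR (beta * H) * (expR (delta * H) - 1) <= v ->
  `|exp_gap p p' xr| <= w ->
  `|exp_gap p p' x| <= w * expR (beta * Num.max 0 (x - xr)) + v.
Proof.
move=> /andP[xr0 xrH] /andP[x0 xH] hA hv hr.
have w0 : 0 <= w by apply: le_trans hr.
have d0 : 0 <= delta by rewrite /delta subr_ge0.
have -> : exp_gap p p' x = expR (p.2 * (x - xr)) * exp_gap p p' xr
    + p'.1 * expR (p.2 * x) * (expR (delta * xr) - expR (delta * x)).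
  have e1 : expR (p.2 * (x - xr)) * expR (p.2 * xr) = expR (p.2 * x).
    by rewrite -expRD; congr expR; ring.
  have e2 : expR (p.2 * (x - xr)) * expR (p'.2 * xr) =
      expR (p.2 * x) * expR (delta * xr).
    by rewrite -!expRD /delta; congr expR; ring.
  have e3 : expR (p'.2 * x) = expR (p.2 * x) * expR (delta * x).
    by rewrite -expRD /delta; congr expR; ring.
  transitivity (p.1 * (expR (p.2 * (x - xr)) * expR (p.2 * xr))
      - p'.1 * (expR (p.2 * (x - xr)) * expR (p'.2 * xr))
      + p'.1 * expR (p.2 * x) * (expR (delta * xr) - expR (delta * x))).
    by rewrite e1 e2 /exp_gap e3; ring.
  by rewrite /exp_gap; ring.
apply: le_trans (ler_normD _ _) _; apply: lerD.
  rewrite normrM gtr0_norm ?expR_gt0 // mulrC; apply: ler_pM => //; rewrite ?expR_ge0 //.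
  rewrite ler_expR; apply: (@le_trans _ _ (p.2 * Num.max 0 (x - xr))).
    by rewrite ler_wpM2l // le_max lexx orbT.
  by apply: ler_wpM2r; [rewrite le_max lexx|exact: le_trans bb' b'beta].
apply: le_trans hv; rewrite !normrM [`|expR _|]gtr0_norm ?expR_gt0 //.
have e1 z : 0 <= z <= H -> 1 <= expR (delta * z) <= expR (delta * H).
  move=> /andP[z0 zH]; rewrite -[leLHS]expR0 !ler_expR.
  by apply/andP; split; [exact: mulr_ge0|exact: ler_wpM2l].
have /e1 /andP[? ?] : 0 <= x <= H by apply/andP.
have /e1 /andP[? ?] : 0 <= xr <= H by apply/andP.
apply: ler_pM; [by apply: mulr_ge0; rewrite ?expR_ge0|exact: normr_ge0| |].
  apply: ler_pM; rewrite ?expR_ge0 //.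
  by rewrite ler_expR; apply: ler_pM => //; exact: le_trans bb' b'beta.
by rewrite ler_norml; apply/andP; split; lra.
Qed.

End Gap.

(** * Certainty equivalence with the largest exponent *)

Lemma continuous_response (R : realType) (y : R) :
  continuous (fun p : R * R => response p y).
Proof.
rewrite (_ : (fun p => _) =
    fun p : R * R => p.1 * (Num.sg y * expR (p.2 * ln `|y|))); last first.
  apply/funext => p; have [->|y0] := eqVneq y 0.
    by rewrite /response /signed_pow sgr0 !mul0r.
  by rewrite response_expR // mulrCA.
move=> p; apply: cvgM; first exact: cvg_fst.
apply: cvgMr; apply: (@cvg_comp _ _ _ (fun q : R * R => q.2 * ln `|y|) expR _ _ _ _
  (@continuous_expR R _)).
by apply: cvgMl; exact: cvg_snd.
Qed.

Section Law.
Variables (R : realType) (W : R) (P : set (R * R)).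

Definition max_exponent (S : set (R * R)) : R * R :=
  xget (0, 0) [set p | S p /\ forall q, S q -> q.2 <= p.2].

(** The parameters that explain the outputs up to time [t] with admissible
    disturbances, when the inputs are those of the law defined below; past inputs
    are recomputed from the outputs. *)
Fixpoint consistent (y : nat -> R) (t : nat) : set (R * R) :=
  match t with
  | 0 => P
  | s.+1 => consistent y s `&` [set p |
      `|y s.+1 - (response p (y s) - response (max_exponent (consistent y s)) (y s))|
        <= W]
  end.

(** The selected parameter has the largest exponent among the consistent ones:
    the true exponent can then only be overestimated, and a large output reveals
    that the true exponent is below the maximum by a definite margin. *)
Definition greedy_law : feedback_law R := fun t h =>
  - response (max_exponent (consistent (nth 0 h) t)) (nth 0 h t).

Lemma eq_consistent (y y' : nat -> R) t : (forall i, (i <= t)%N -> y i = y' i) ->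
  consistent y t = consistent y' t.
Proof.
elim: t => //= t IH yy'; rewrite IH => [|i it]; last by rewrite yy' // leqW.
by rewrite !yy'.
Qed.

Lemma consistentW (y : nat -> R) s t : (s <= t)%N -> consistent y t `<=` consistent y s.
Proof.
elim: t => [|t IH]; first by rewrite leqn0 => /eqP ->.
rewrite leq_eqVlt => /predU1P[->//|]; rewrite ltnS => /IH st.
by move=> p [/st].
Qed.

Lemma compact_consistent (y : nat -> R) t : compact P -> compact (consistent y t).
Proof.
move=> cP; elim: t => //= t IH; apply: compact_closedI => //.
set d := response _ _.
apply: (@preimage_closed _ _ (fun p => `|y t.+1 - (response p (y t) - d)|)
  [set x | x <= W]); last first.
  exact: closed_le.
move=> p _; apply: cvg_norm; apply: cvgB; first exact: cvg_cst.
by apply: cvgB; [exact: continuous_response|exact: cvg_cst].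
Qed.

Lemma max_exponentP (S : set (R * R)) : compact S -> S !=set0 ->
  S (max_exponent S) /\ forall q, S q -> q.2 <= (max_exponent S).2.
Proof.
move=> cS S0; have [//|//||c cS' cmax] := @compact_EVT_max _ R snd S.
  by apply: continuous_subspaceT => p; exact: cvg_snd.
apply: (@xgetPex _ (0, 0) [set p | S p /\ forall q, S q -> q.2 <= p.2]).
by exists c; split; [exact/set_mem|move=> q Sq; apply: cmax; exact/mem_set].
Qed.

(** The true and the selected parameter are both consistent with each past
    transition, hence their responses there differ by at most [2 * W]. *)
Lemma greedy_law_run (p : R * R) (y0 : R) (w : nat -> R) :
  compact P -> P p -> admissible_disturbance W w ->
  let y := trajectory greedy_law p y0 w in
  forall t, exists p' : R * R, [/\ P p', p.2 <= p'.2,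
    `|y t.+1| <= `|response p (y t) - response p' (y t)| + W &
    forall s, (s < t)%N -> `|response p (y s) - response p' (y s)| <= 2 * W].
Proof.
move=> cP Pp hw y.
have yS t : y t.+1 =
    response p (y t) - response (max_exponent (consistent y t)) (y t) + w t.+1.
  rewrite /y trajectoryS -/y /greedy_law /response; congr (_ - _ * signed_pow _ _ + _).
  - congr (max_exponent _).1; apply: eq_consistent => i it.
    by rewrite -[i]/(val (Ordinal (it : (i < t.+1)%N))) -tnth_nth tnth_mktuple.
  - congr (max_exponent _).2; apply: eq_consistent => i it.
    by rewrite -[i]/(val (Ordinal (it : (i < t.+1)%N))) -tnth_nth tnth_mktuple.
  - by rewrite -[in LHS](_ : val (@ord_max t) = t) // -tnth_nth tnth_mktuple.
have pin t : consistent y t p.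
  elim: t => //= t IH; split => //=; rewrite yS.
  by rewrite addrC addKr; exact: hw.
move=> t; have := max_exponentP (compact_consistent (y := y) (t := t) cP) (ex_intro _ p (pin t)).
set p' := max_exponent _ => -[hp' pmax].
exists p'; split.
- exact: (consistentW (leq0n t) hp').
- exact: pmax.
- by rewrite yS; apply: le_trans (ler_normD _ _) _; rewrite lerD2l; exact: hw.
move=> s st; have /= [_ h1] := consistentW st (pin t); have /= [_ h2] := consistentW st hp'.
set d := response (max_exponent _) _ in h1 h2.
rewrite (_ : response p _ - _ =
  (y s.+1 - (response p' (y s) - d)) - (y s.+1 - (response p (y s) - d))); last by ring.
by apply: le_trans (ler_normB _ _) _; lra.
Qed.

End Law.

(** * Chains of milestones *)

(** Here [w], [v], [u] are three consecutive milestones, with ratios at most [s],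
    and [z] is the next one.  The term [critical * (u - w)] alone gives
    [z <= s u] by [critical_cubic]; the gain [eta (v - w) >= eta u / 20] pays for
    the drop [e = eta / 40] and for the constant [C]. *)
Lemma ratio_drop_extrapolation (R : realType) (s eta e C u v w z : R) :
  let lam := 6 / 5 : R in
  0 < eta -> e = eta / 40 -> 0 < s -> s <= 16 / 5 ->
  0 < w -> lam * w <= v -> v <= s * w -> v <= u -> u <= s * v -> C <= e * u ->
  z <= critical R * (u - w) - eta * (v - w) + C -> z <= (s - e) * u.
Proof.
move=> lam eta0 eE s0 s1 w0 wv vw vu uv Cu.
have b0 := critical_bounds R; move: b0 => /andP[b1 b2].
have cub := critical_cubic (ltW s0).
have u0 : 0 < u by rewrite /lam in wv; lra.
have h1 : critical R * (u - w) <= s * u.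
  rewrite -(ler_pM2r (exprn_gt0 2 s0)).
  apply: (@le_trans _ _ (critical R * (s ^+ 2 - 1) * u)); last first.
    rewrite (_ : s * u * _ = s ^+ 3 * u); last by ring.
    by rewrite ler_wpM2r // ltW.
  have : u <= s ^+ 2 * w by nra.
  nra.
have h2 : eta * u / 20 <= eta * (v - w).
  have : u / 20 <= v - w by rewrite /lam in wv; nra.
  nra.
rewrite eE in Cu *; nra.
Qed.

(** Here [s^2 - (13 / 5) lam s + 13 / 5] has negative discriminant because
    [(13 / 5) lam^2 < 4] for [lam = 6 / 5]; this leaves room for a drop of
    [2 / 50], half of which pays for [C]. *)
Lemma ratio_drop_interpolation (R : realType) (s e C u v r z : R) :
  let lam := 6 / 5 : R in
  e <= 1 / 50 -> lam <= s -> s <= 16 / 5 ->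
  0 < v -> 0 < u -> u <= s * v -> u <= r -> C <= e * r ->
  z <= critical R * (lam * u - v) + C -> z <= (s - e) * r.
Proof.
move=> lam e0 s0 s1 v0 u0 uv ur Cr.
have /andP[b1 b2] := critical_bounds R.
have h : critical R * (lam * u - v) <= (s - 2 / 50) * u.
  have : critical R * (lam * s - 1) <= (s - 2 / 50) * s.
    apply: (@le_trans _ _ (13 / 5 * (lam * s - 1))).
      by apply: ler_wpM2r => //; rewrite /lam in s0 *; lra.
    by have := sqr_ge0 (s - 79 / 50); rewrite /lam; nra.
  move=> hs; have s_gt0 : 0 < s by rewrite /lam in s0; lra.
  rewrite -(ler_pM2r s_gt0); nra.
have : (s - 2 / 50) * u <= (s - 2 / 50) * r by rewrite /lam in s0; nra.
nra.
Qed.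

Lemma geometric_growth (R : realType) (lam : R) (r : nat -> R) (n : nat) :
  1 <= lam -> (forall k, (k.+1 < n)%N -> lam * r k <= r k.+1) ->
  forall i k, (i + k < n)%N -> lam ^+ k * r i <= r (i + k)%N.
Proof.
move=> lam1 hr i; elim=> [|k IH] ik; first by rewrite expr0 mul1r addn0.
rewrite addnS exprS -mulrA; apply: le_trans (hr _ _); last by rewrite -addnS.
by rewrite ler_wpM2l ?IH //; [lra|rewrite -ltnS -addnS (leq_trans ik)].
Qed.

(** From the fourth milestone on, the bound on a milestone depends on the output
    just before it: that output is the latest milestone itself, extrapolated from
    the two milestones before; or it lies between two neighbouring milestones, or
    above the latest one by less than the factor [lam]; or it lies below the first
    milestone. *)
Definition milestone_chain (R : realType) (eta C X : R) (r : nat -> R) (n : nat) : Prop :=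
  let lam := 6 / 5 : R in
  X <= r 0%N /\ forall k, (k.+1 < n)%N ->
  [/\ lam * r k <= r k.+1, r k.+1 <= 16 / 5 * r k &
    [\/ (k <= 1)%N,
       (2 <= k)%N /\ r k.+1 <= critical R * (r k - r k.-2) - eta * (r k.-1 - r k.-2) + C,
       (exists2 j, (j < k)%N & r k.+1 <= critical R * (lam * r j.+1 - r j) + C) |
       r k.+1 <= 16 / 5 * r 0%N ]].

(** Each block of ten milestones lowers the bound on the ratio of consecutive
    milestones by [e = eta / 40], starting from [16 / 5]; as the ratio is at least
    [6 / 5], the chain stops.  A milestone cannot arise from one that lies ten or
    more steps back, since [(6 / 5)^10 >= 4 > 16 / 5], so the ratios that matter
    are covered by the previous block.  The first [K] milestones are discarded to
    make [C] negligible. *)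
Lemma milestone_chain_short (R : realType) (eta C : R) : 0 < eta <= 4 / 5 ->
  exists N, forall X r n, 1 <= X -> 100 * C <= X -> milestone_chain eta C X r n -> (n <= N)%N.
Proof.
move=> /andP[eta0 eta1].
pose e := eta / 40.
have e0 : 0 < e by rewrite divr_gt0.
pose lam := 6 / 5 : R.
have lam_lin k : 1 + k%:R / 5 <= lam ^+ k.
  elim: k => [|k IH]; first by rewrite mul0r addr0 expr0.
  have -> : lam ^+ k.+1 = 6 / 5 * lam ^+ k by rewrite exprS.
  have : 0 <= k%:R / 5 :> R by rewrite divr_ge0.
  by rewrite -[k.+1%:R]natr1; lra.
pose K := Num.bound (5 * `|C| / e).
have hK k : (K <= k)%N -> C <= e * lam ^+ k.
  move=> Kk; apply: le_trans (ler_norm C) _.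
  have : 5 * `|C| / e <= K%:R.
    by apply/ltW/archi_boundP; rewrite divr_ge0 ?mulr_ge0 // ltW.
  rewrite ler_pdivrMr // => h.
  have := lam_lin k; have : (K%:R : R) <= k%:R by rewrite ler_nat.
  nra.
pose M := Num.bound (2 / e).
have hM : 2 < M%:R * e.
  by rewrite -ltr_pdivrMr //; apply: archi_boundP; rewrite divr_ge0 // ltW.
exists (K + 10 * M.+1).+1 => X r n X1 XC [r0 hr].
have r_pos i : (i < n)%N -> 1 <= r i.
  elim: i => [|i IH] ni; first exact: le_trans r0.
  have [h _ _] := hr i ni; have := IH (ltnW ni); lra.
have hlam k : (k.+1 < n)%N -> lam * r k <= r k.+1 by move=> /hr[].
have lam1 : 1 <= lam by rewrite /lam; lra.
have grow := geometric_growth lam1 hlam.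
have lam10 k : (10 <= k)%N -> 4 <= lam ^+ k.
  move=> k10; apply: (@le_trans _ _ (lam ^+ 10)); last by rewrite ler_weXn2l.
  by have := lam_lin 5; rewrite (exprD lam 5 5); nra.
have C_small i : (i < n)%N -> 100 * C <= r i.
  elim: i => [|i IH] ni; first exact: le_trans r0.
  have [h _ _] := hr i ni; have := IH (ltnW ni); have := r_pos _ (ltnW ni).
  lra.
have far i k : (i + k < n)%N -> (10 <= k)%N -> ~ r (i + k)%N <= 16 / 5 * r i.
  move=> ik k10; have := grow i k ik; have := lam10 k k10.
  have := r_pos i (leq_ltn_trans (leq_addr _ _) ik); nra.
have Cr k : (K <= k)%N -> (k < n)%N -> C <= e * r k.
  move=> Kk kn; apply: le_trans (hK k Kk) _; rewrite ler_pM2l //.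
  have := grow 0%N k; rewrite add0n => /(_ kn).
  have := r_pos 0%N (leq_ltn_trans (leq0n _) kn).
  have : 0 <= lam ^+ k by rewrite exprn_ge0 //; lra.
  nra.
have drop m : forall k, (K + 10 * m <= k)%N -> (k.+1 < n)%N ->
    r k.+1 <= (16 / 5 - m%:R * e) * r k.
  elim: m => [|m IH] k mk kn; first by rewrite mul0r subr0; have [] := hr k kn.
  have le10 : (K + 10 * m + 10 <= k)%N by rewrite -addnA -mulnSr.
  have k10 : (10 <= k)%N by rewrite (leq_trans _ le10) // leq_addl.
  set s := 16 / 5 - m%:R * e in IH.
  have -> : 16 / 5 - m.+1%:R * e = s - e by rewrite /s -natr1; ring.
  have s1 : s <= 16 / 5 by rewrite /s gerBl mulr_ge0 // ltW.
  have IHk j : (K + 10 * m <= j)%N -> (j <= k)%N -> r j.+1 <= s * r j.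
    by move=> mj jk; apply: IH => //; rewrite (leq_ltn_trans _ kn).
  case: k mk kn le10 k10 IHk => [//|[//|k]] mk kn le10 k10 IHk.
  have kK : (K + 10 * m <= k)%N.
    by move: le10; clear; move: (10 * m)%N => ?; lia.
  have [k1n k2n] : (k.+2 < n)%N /\ (k.+1 < n)%N by split; rewrite ltnW // ltnW.
  have rk := r_pos k (ltnW k2n); have rk1 := r_pos _ k2n.
  have sk : lam <= s.
    have := IHk k.+1 (leqW kK) (leqnSn _); have := hlam k.+1 k1n.
    nra.
  have Ck : C <= e * r k.+2.
    by apply: Cr => //; rewrite (leq_trans (leq_addr (10 * m) K)) // (leq_trans kK) // !leqW.
  have [h1 h2] := hr k.+2 kn.
  case=> [//|[_ hA]|[j jk hB]|hC].
  - apply: (ratio_drop_extrapolation (eta := eta) (C := C) (v := r k.+1) (w := r k)) hA => //.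
    + by apply: lt_le_trans sk; rewrite /lam; lra.
    + by apply: lt_le_trans rk.
    + exact: hlam.
    + exact: IHk (leq_trans (leqnSn _) (leqnSn _)).
    + have := hlam _ k1n; nra.
    + by apply: IHk => //; exact: leqW.
  - have jn : (j.+1 < n)%N by rewrite (leq_ltn_trans jk) // ltnW.
    have rj := r_pos j (ltnW jn); have rj1 := r_pos _ jn.
    have [jK|jK] := leqP (K + 10 * m) j.
      apply: (ratio_drop_interpolation _ sk s1 _ _ _ _ Ck hB).
      + by rewrite /e; lra.
      + by lra.
      + by lra.
      + by apply: IHk => //; exact: ltnW.
      + have := grow j.+1 (k.+2 - j.+1)%N; rewrite subnKC // => /(_ (ltnW kn)).
        have : 1 <= lam ^+ (k.+2 - j.+1) by exact: exprn_ege1.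
        nra.
    have jk' : (j.+1 <= k.+3)%N by rewrite (leq_trans jk).
    exfalso; apply: (far j.+1 (k.+3 - j.+1)%N); rewrite ?subnKC //.
    + by move: le10 jK jk'; clear; move: (10 * m)%N => ?; lia.
    + have /andP[b1 b2] := critical_bounds R.
      have CS := C_small _ jn; apply: le_trans hB _; nra.
  - exfalso; apply: (far 0%N k.+3) => //.
    by rewrite (leq_trans k10).
rewrite leqNgt; apply/negP => hn.
have := drop M.+1 (K + 10 * M.+1)%N (leqnn _) hn.
have := hlam _ hn; have := r_pos _ (ltnW hn).
have : (M%:R : R) * e <= M.+1%:R * e by apply: ler_wpM2r; [exact: ltW|rewrite ler_nat].
rewrite /lam; nra.
Qed.

(** * Milestones of a run *)

(** [tau 0, ..., tau n.-1] are the milestone times up to time [t].  The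
    predecessors are recorded because they carry the outputs that produced the
    milestones. *)
Record milestones (R : realType) (X : R) (x : nat -> R) (t n : nat)
    (tau : nat -> nat) : Prop := Milestones {
  milestone_le : forall k, (k < n)%N -> (tau k <= t)%N;
  milestone_first : (0 < n)%N ->
    X <= x (tau 0%N) /\ (tau 0%N = 0%N \/ x (tau 0%N).-1 < X);
  milestone_next : forall k, (k.+1 < n)%N ->
    [/\ (tau k < tau k.+1)%N, 6 / 5 * x (tau k) <= x (tau k.+1) &
       x (tau k.+1).-1 <= 6 / 5 * x (tau k)];
  milestone_now : if n is m.+1 then x t <= 6 / 5 * x (tau m) else x t < X
}.

Lemma milestones_exist (R : realType) (X : R) (x : nat -> R) : 0 < X ->
  (forall t, 0 <= x t) -> forall t, exists n tau, milestones X x t n tau.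
Proof.
move=> X0 x0; elim=> [|t [n [tau [le_t first next now]]]].
  have [hX|hX] := lerP X (x 0%N); last by exists 0%N, id; split.
  exists 1%N, (fun=> 0%N); split => //; first by split => //; left.
  by have := x0 0%N; lra.
case: n le_t first next now => [|m] le_t first next now.
  have [hX|hX] := lerP X (x t.+1); last by exists 0%N, id; split.
  exists 1%N, (fun=> t.+1); split => //; first by split => //; right.
  by have := x0 t.+1; lra.
have [hX|hX] := lerP (6 / 5 * x (tau m)) (x t.+1); last first.
  by exists m.+1, tau; split => //; [move=> k /le_t/leqW|exact: ltW].
exists m.+2, (fun k => if (k <= m)%N then tau k else t.+1); split => //.
- by move=> k _; case: (leqP k m) => // km; apply: leqW; exact: le_t.
- move=> k; rewrite !ltnS => km; rewrite km.
  case: (leqP k.+1 m) => km'; first exact: next.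
  have -> : k = m by apply/eqP; rewrite eqn_leq km -ltnS.
  by split => //=; rewrite ltnS le_t.
- by rewrite ltnn; have := x0 t.+1; lra.
Qed.

Lemma bracket (R : realType) (r : nat -> R) (v : R) k : r 0%N <= v -> v < r k ->
  exists2 j, (j < k)%N & r j <= v <= r j.+1.
Proof.
elim: k => [|k IH] r0 rk; first by move: (le_lt_trans r0 rk); rewrite ltxx.
have [h|h] := ltP v (r k); last by exists k => //; rewrite h ltW.
by have [j jk hj] := IH r0 h; exists j => //; exact: leqW.
Qed.

Section Run.
Variables (R : realType) (C X : R) (x : nat -> R).
Hypotheses (C0 : 0 <= C) (X1 : 1 <= X) (XC : 100 * C <= X).
Hypothesis one_step : forall t, x t.+1 <= critical R * x t + C.

Section Fixed.
Variables (t n : nat) (tau : nat -> nat).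
Hypothesis ms : milestones X x t n tau.

Lemma milestone_ge k : (k < n)%N -> X <= x (tau k).
Proof.
have [C0' [X1' XC']] : 0 <= C /\ 1 <= X /\ 100 * C <= X by [].
elim: k => [|k IH] kn; first by case: (milestone_first ms kn).
have [_ h _] := milestone_next ms kn; have := IH (ltnW kn); lra.
Qed.

Lemma milestone_mono i k : (i < k)%N -> (k < n)%N -> (tau i < tau k)%N.
Proof.
elim: k => [//|k IH]; rewrite ltnS leq_eqVlt => /predU1P[->|ik] kn.
  by have [] := milestone_next ms kn.
by have [h _ _] := milestone_next ms kn; apply: ltn_trans h; exact: IH (ltnW kn).
Qed.

Lemma milestone_next_le k : (k.+1 < n)%N -> x (tau k.+1) <= 16 / 5 * x (tau k).
Proof.
have [C0' [X1' XC']] : 0 <= C /\ 1 <= X /\ 100 * C <= X by [].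
move=> kn; have [kk _ h] := milestone_next ms kn.
have hX := milestone_ge (ltnW kn); have /andP[b1 b2] := critical_bounds R.
have r1 : 1 <= x (tau k) by exact: le_trans hX.
have := one_step (tau k.+1).-1; rewrite prednK ?(leq_ltn_trans _ kk) //; nra.
Qed.

Lemma milestone_bound (B : R) k : x 0%N <= B -> critical R * X + C <= B ->
  (k < n)%N -> x (tau k) <= (16 / 5) ^+ k * B.
Proof.
have [C0' [X1' XC']] : 0 <= C /\ 1 <= X /\ 100 * C <= X by [].
move=> x0B XB; elim: k => [|k IH] kn.
  rewrite expr0 mul1r; have [_ [->//|h]] := milestone_first ms kn.
  have [->//|t0] := eqVneq (tau 0%N) 0%N.
  have /andP[b1 b2] := critical_bounds R.
  by have := one_step (tau 0%N).-1; rewrite prednK ?lt0n //; nra.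
rewrite exprS -mulrA; apply: le_trans (milestone_next_le kn) _.
by rewrite ler_wpM2l ?IH // ltnW.
Qed.

Lemma run_bound (B : R) N : x 0%N <= B -> critical R * X + C <= B -> (n <= N)%N ->
  x t <= 6 / 5 * (16 / 5) ^+ N * B.
Proof.
have [C0' [X1' XC']] : 0 <= C /\ 1 <= X /\ 100 * C <= X by [].
move=> x0B XB nN; have /andP[b1 b2] := critical_bounds R.
have BX : X <= B by nra.
have e1 k : 1 <= (16 / 5 : R) ^+ k by apply: exprn_ege1; lra.
have := milestone_now ms; case: n nN (@milestone_bound B) => [|m] mN hB h.
  by have := e1 N; nra.
have := hB m x0B XB (ltnSn m).
have : (16 / 5 : R) ^+ m <= (16 / 5) ^+ N.
  by rewrite ler_weXn2l ?(leq_trans _ mN) //; lra.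
move: ((16 / 5 : R) ^+ m) ((16 / 5 : R) ^+ N) => u v; nra.
Qed.

(** The output preceding a milestone is either the latest milestone, not yet
    observed, or an output below [6 / 5] of the latest milestone, for which all
    milestones so far are observed data; its prediction then uses the two
    milestones around it, or the last two if it exceeds them all. *)
Lemma run_chain (eta : R) : 0 <= eta ->
  (forall t r s, (r < t)%N -> (s < t)%N -> 0 < x s -> x s <= x t <= x r ->
     x t.+1 <= critical R * (x t - x s) + C) ->
  (forall t r s, (r < t)%N -> (s < t)%N -> 0 < x s -> x s <= x r <= x t ->
     x t - x r <= 14 * (x r - x s) ->
     x t.+1 <= critical R * (x t - x s) - eta * (x r - x s) + C) ->
  milestone_chain eta C X (fun k => x (tau k)) n \/ n = 0%N.
Proof.
have [C0' [X1' XC']] : 0 <= C /\ 1 <= X /\ 100 * C <= X by [].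
move=> eta0 interp extrap.
have [->|n0] := posnP n; [by right|left].
have /andP[b1 b2] := critical_bounds R.
split; first by case: (milestone_first ms n0).
move=> k kn; have [kk hlam hm] := milestone_next ms kn.
split => //; first exact: milestone_next_le.
case: k kn kk hlam hm => [|[|k]] kn kk hlam hm; [exact: Or41|exact: Or41|].
have kn1 := ltnW kn; have kn2 := ltnW kn1.
have Xk := milestone_ge kn1; have Xk1 := milestone_ge kn2.
have Xk0 := milestone_ge (ltnW kn2).
have [_ l1 _] := milestone_next ms kn1; have [_ l0 _] := milestone_next ms kn2.
have u1 := milestone_next_le kn1.
have tk1 := milestone_mono (ltnSn k.+1) kn1.
have tk0 := ltn_trans (milestone_mono (ltnSn k) kn2) tk1.
have mE : (tau k.+3).-1.+1 = tau k.+3 by rewrite prednK // (leq_ltn_trans _ kk).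
have : (tau k.+2 <= (tau k.+3).-1)%N by rewrite -ltnS mE.
move: mE hm; set m := (tau k.+3).-1 => mE hm.
rewrite leq_eqVlt => /predU1P[mk|km].
  apply: Or42; split => //=; rewrite -mE -mk; apply: extrap => //; lra.
have [h0|h0] := ltP (x m) (x (tau 0%N)).
  apply: Or44; rewrite -mE; have := one_step m.
  have := milestone_ge (leq_ltn_trans (leq0n _) kn); nra.
apply: Or43.
have [hk|hk] := ltP (x m) (x (tau k.+2)); last first.
  exists k.+1 => //; rewrite -mE.
  have := extrap m (tau k.+2) (tau k.+1) km (ltn_trans tk1 km).
  move=> /(_ _ _ _)/le_trans; apply; first lra; first by apply/andP; split; lra.
    lra.
  have : 0 <= eta * (x (tau k.+2) - x (tau k.+1)) by rewrite mulr_ge0 // subr_ge0; lra.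
  nra.
have [j jk /andP[j1 j2]] := @bracket R (fun i => x (tau i)) _ _ h0 hk.
exists j => //; rewrite -mE.
have jn : (j.+1 < n)%N by rewrite (leq_ltn_trans _ kn1).
have Xj := milestone_ge (ltnW jn); have Xj1 := milestone_ge jn.
have jm : (tau j.+1 < m)%N.
  apply: leq_ltn_trans km; move: jk; rewrite leq_eqVlt => /predU1P[[->]//|jk].
  by apply/ltnW/milestone_mono.
have jm' : (tau j < m)%N by apply: ltn_trans jm; exact: milestone_mono.
apply: le_trans (interp m (tau j.+1) (tau j) jm jm' _ _) _.
- lra.
- by apply/andP.
- nra.
Qed.

(** Each milestone follows the previous one immediately, because an observed
    milestone predicts every output up to [6 / 5] of its log-size too well to
    produce another.  Then [r_{k+1} <= beta (r_k - r_{k-1}) + C] for [k >= 1] and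
    [r_1 <= beta r_0 + C], which force [r_3 < (6 / 5) r_2] because [beta] satisfies
    [beta^2 - 3 beta + 1 < 0]. *)
Lemma run_short (B : R) : x 0%N <= B -> critical R * X + C <= B ->
  (forall t r, (r < t)%N -> 0 < x r <= 13 * B -> x t <= 13 * B ->
     x t.+1 <= critical R * Num.max 0 (x t - x r) + C) ->
  (n <= 3)%N.
Proof.
have [C0' [X1' XC']] : 0 <= C /\ 1 <= X /\ 100 * C <= X by [].
move=> x0B XB single; rewrite leqNgt; apply/negP => n3.
have /andP[b1 b2] := critical_bounds R.
have BX : X <= B by nra.
have bd k : (k <= 2)%N -> x (tau k) <= 21 / 2 * B.
  move=> k2; apply: le_trans (milestone_bound x0B XB (leq_ltn_trans k2 (ltnW n3))) _.
  apply: ler_wpM2r; first lra.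
  apply: (@le_trans _ _ ((16 / 5) ^+ 2)); first by rewrite ler_weXn2l //; lra.
  by rewrite expr2; lra.
have ge k : (k <= 3)%N -> X <= x (tau k) by move=> k3; apply: milestone_ge (leq_ltn_trans k3 n3).
have consec k : (k <= 2)%N -> tau k.+1 = (tau k).+1.
  move=> k2; have kn : (k.+1 < n)%N by rewrite (leq_ltn_trans _ n3).
  have [kk hlam hm] := milestone_next ms kn.
  have mE : (tau k.+1).-1.+1 = tau k.+1 by rewrite prednK // (leq_ltn_trans _ kk).
  have : (tau k <= (tau k.+1).-1)%N by rewrite -ltnS mE.
  move: mE hm; set m := (tau k.+1).-1 => mE hm.
  rewrite -mE leq_eqVlt => /predU1P[<-//|km]; exfalso.
  have hx := bd k k2; have hX := ge k (leqW k2).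
  have : x (tau k.+1) <= critical R * Num.max 0 (x m - x (tau k)) + C.
    by rewrite -mE; apply: single => //; [apply/andP; split; lra|lra].
  have : Num.max 0 (x m - x (tau k)) <= x (tau k) / 5.
    by rewrite ge_max; apply/andP; split; lra.
  nra.
have e1 := consec 0%N isT; have e2 := consec 1%N isT; have e3 := consec 2%N isT.
have h1 := one_step (tau 0%N); rewrite -e1 in h1.
have l k : (k <= 2)%N -> 6 / 5 * x (tau k) <= x (tau k.+1).
  by move=> k2; have [] := milestone_next ms (leq_ltn_trans (k2 : (k.+1 <= 3)%N) n3).
have step k : (k <= 1)%N ->
    x (tau k.+2) <= critical R * (x (tau k.+1) - x (tau k)) + C.
  move=> k1; have k2 := leqW k1; rewrite consec //.
  have hl := l k k2; have hX := ge k (leqW k2).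
  have := single (tau k.+1) (tau k); rewrite {1}consec // ltnSn => /(_ isT).
  rewrite [Num.max _ _]max_r; last lra.
  by apply; [have := bd k k2|have := bd k.+1 k1]; move: BX X1;
    [move=> ? ? ?; apply/andP; split|]; lra.
have h2 := step 0%N isT; have h3 := step 1%N isT.
have := l 0%N isT; have := l 1%N isT; have := l 2%N isT; have := ge 0%N isT.
nra.
Qed.

End Fixed.
End Run.

(** * Stabilization *)

(** Truncated at [0], so that small outputs count as size [1]. *)
Definition log_size (R : realType) (y : R) : R := ln (Num.max 1 `|y|).

Lemma log_size_ge0 (R : realType) (y : R) : 0 <= log_size y.
Proof. by rewrite ln_ge0 // le_max lexx. Qed.

Lemma log_size_gt0 (R : realType) (y : R) : 0 < log_size y ->
  y != 0 /\ log_size y = ln `|y|.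
Proof.
rewrite /log_size; have [|y1] := leP `|y| 1; first by rewrite ln1 ltxx.
by move=> _; split => //; rewrite -normr_gt0; exact: lt_trans y1.
Qed.

Lemma log_size_le (R : realType) (y E D : R) : 0 <= E -> 1 <= D ->
  `|y| <= D * expR E -> log_size y <= E + ln D.
Proof.
move=> E0 D1 yE; have D0 : 0 < D by exact: lt_le_trans D1.
rewrite -[E in leRHS]expRK addrC -lnM ?posrE ?expR_gt0 //.
rewrite ler_ln ?posrE ?lt_max ?ltr01 ?mulr_gt0 ?expR_gt0 //.
rewrite ge_max yE andbT -[leLHS]mulr1; apply: ler_pM => //.
by rewrite -expR0 ler_expR.
Qed.

Lemma response_gap (R : realType) (p p' : R * R) (y : R) : y != 0 ->
  `|response p y - response p' y| = `|exp_gap p p' (ln `|y|)|.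
Proof.
by move=> y0; rewrite !response_expR // -mulrBr normrM normr_sg y0 mul1r.
Qed.

Lemma response_le (R : realType) (p : R * R) (A beta y : R) :
  `|p.1| <= A -> 0 <= p.2 <= beta -> `|response p y| <= A * expR (beta * log_size y).
Proof.
move=> pA /andP[p0 pb]; have A0 : 0 <= A by exact: le_trans pA.
have [->|y0] := eqVneq y 0.
  by rewrite /response /signed_pow sgr0 mul0r mulr0 normr0 mulr_ge0 ?expR_ge0.
rewrite norm_response //; apply: ler_pM => //; rewrite ?expR_ge0 //.
rewrite ler_expR; apply: (@le_trans _ _ (p.2 * log_size y)).
  apply: ler_wpM2l => //; rewrite ler_ln ?posrE ?lt_max ?ltr01 ?normr_gt0 //.
  by rewrite le_max lexx orbT.
by apply: ler_wpM2r => //; exact: log_size_ge0.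
Qed.

Section RunBounds.
Variables (R : realType) (W A bbar : R) (P : set (R * R)) (p : R * R) (y : nat -> R).
Hypotheses (W0 : 0 < W) (A1 : 1 <= A).
Hypothesis P_le : forall q, P q -> [/\ `|q.1| <= A, 0 <= q.2 & q.2 <= bbar].
Hypothesis bbar_le : bbar <= critical R.
Hypothesis Pp : P p.
Hypothesis run : forall t, exists p' : R * R, [/\ P p', p.2 <= p'.2,
    `|y t.+1| <= `|response p (y t) - response p' (y t)| + W &
    forall s, (s < t)%N -> `|response p (y s) - response p' (y s)| <= 2 * W].

Let x t := log_size (y t).
Let D := 2 * A + 60 * W + 1.

(** The constant [D] dominates all four prediction bounds below; for the
    extrapolation with [n = 14] it has to exceed [(1 + 2 * 14) * 2 * W + W]. *)
Lemma next_le t E : 0 <= E -> (forall p', P p' -> p.2 <= p'.2 ->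
    (forall s, (s < t)%N -> 0 < x s -> `|exp_gap p p' (x s)| <= 2 * W) ->
    `|response p (y t) - response p' (y t)| <= (2 * A + 59 * W) * expR E) ->
  x t.+1 <= E + ln D.
Proof.
have [W0' A1'] := (W0, A1).
move=> E0 h; have [p' [Pp' pp' hy hs]] := run t.
apply: log_size_le => //; first by rewrite /D; lra.
apply: le_trans hy _; have eE : 1 <= expR E by rewrite -expR0 ler_expR.
apply: (@le_trans _ _ ((2 * A + 59 * W) * expR E + W)); last by rewrite /D; nra.
rewrite lerD2r; apply: h => // s st xs.
have [ys xE] := log_size_gt0 xs.
by rewrite /x xE -response_gap //; exact: hs.
Qed.

(** Without any data both responses are bounded by the largest gain. *)
Lemma run_one_step t : x t.+1 <= critical R * x t + ln D.
Proof.
have [W0' A1'] := (W0, A1); have /andP[b1 b2] := critical_bounds R.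
have xt : 0 <= x t := log_size_ge0 _.
have E0 : 0 <= critical R * x t by rewrite mulr_ge0 //; lra.
apply: next_le => // p' Pp' _ _.
have [pA p0 pb] := P_le Pp; have [pA' p0' pb'] := P_le Pp'.
apply: le_trans (ler_normB _ _) _.
have hp : `|response p (y t)| <= A * expR (critical R * x t).
  by apply: response_le => //; rewrite p0 (le_trans pb).
have hp' : `|response p' (y t)| <= A * expR (critical R * x t).
  by apply: response_le => //; rewrite p0' (le_trans pb').
have := expR_ge0 (critical R * x t); nra.
Qed.

Lemma run_interp t r s : (r < t)%N -> (s < t)%N -> 0 < x s -> x s <= x t <= x r ->
  x t.+1 <= critical R * (x t - x s) + ln D.
Proof.
have [W0' A1'] := (W0, A1); have /andP[b1 b2] := critical_bounds R.
move=> rt st xs /andP[str trr]; have xt := lt_le_trans xs str.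
have xr := lt_le_trans xt trr.
have E0 : 0 <= critical R * (x t - x s) by rewrite mulr_ge0 ?subr_ge0 //; lra.
apply: next_le => // p' Pp' pp' data.
have [pA p0 pb] := P_le Pp; have [pA' p0' pb'] := P_le Pp'.
have [yt xtE] := log_size_gt0 xt; rewrite response_gap // -xtE.
apply: le_trans (exp_gap_interp p0 pp' (le_trans pb' bbar_le) _ (data s st xs) (data r rt xr)) _.
  by rewrite str.
by rewrite ler_wpM2r ?expR_ge0 //; lra.
Qed.

Lemma run_extrap eta t r s : 0 <= eta <= 1 -> p.2 <= bbar - eta ->
  (r < t)%N -> (s < t)%N -> 0 < x s -> x s <= x r <= x t ->
  x t - x r <= 14 * (x r - x s) ->
  x t.+1 <= critical R * (x t - x s) - eta * (x r - x s) + ln D.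
Proof.
have [W0' A1'] := (W0, A1); have /andP[b1 b2] := critical_bounds R.
move=> /andP[eta0 eta1] peta rt st xs /andP[sr rt'] ratio.
have xr := lt_le_trans xs sr; have xt := lt_le_trans xr rt'.
have E0 : 0 <= critical R * (x t - x s) - eta * (x r - x s) by nra.
apply: next_le => // p' Pp' pp' data.
have [pA p0 pb] := P_le Pp; have [pA' p0' pb'] := P_le Pp'.
have [yt xtE] := log_size_gt0 xt; rewrite response_gap // -xtE.
have hb : p.2 <= critical R - eta by apply: le_trans peta _; rewrite lerB.
apply: le_trans (exp_gap_extrap (n := 14) p0 pp' (le_trans pb' bbar_le) sr rt' ratio hb
  (data s st xs) (data r rt xr)) _.
by rewrite ler_wpM2r ?expR_ge0 //; lra.
Qed.

Lemma run_single eta H t r : bbar - eta <= p.2 -> 0 < H ->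
  A * expR (critical R * H) * (expR (eta * H) - 1) <= W ->
  (r < t)%N -> 0 < x r <= H -> x t <= H ->
  x t.+1 <= critical R * Num.max 0 (x t - x r) + ln D.
Proof.
have [W0' A1'] := (W0, A1); have /andP[b1 b2] := critical_bounds R.
move=> peta H0 hH rt /andP[xr xrH] xtH.
have M0 : 0 <= Num.max 0 (x t - x r) by rewrite le_max lexx.
have E0 : 0 <= critical R * Num.max 0 (x t - x r) by rewrite mulr_ge0 //; lra.
have [xt0|xt] := lerP (x t) 0.
  apply: le_trans (run_one_step t) _; rewrite lerD2r ler_wpM2l //; first lra.
  exact: le_trans xt0 M0.
apply: next_le => // p' Pp' pp' data.
have [pA p0 pb] := P_le Pp; have [pA' p0' pb'] := P_le Pp'.
have [yt xtE] := log_size_gt0 xt; rewrite response_gap // -xtE.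
have hd : A * expR (critical R * H) * (expR ((p'.2 - p.2) * H) - 1) <= W.
  apply: le_trans hH; apply: ler_wpM2l.
    by apply: mulr_ge0; [lra|exact: expR_ge0].
  rewrite lerD2r ler_expR; apply: ler_wpM2r; first exact: ltW.
  by lra.
apply: le_trans (@exp_gap_single _ p p' _ _ p0 pp' (le_trans pb' bbar_le) A H W (x r) (x t)
  _ _ pA' hd (data r rt xr)) _.
- by rewrite ltW.
- by rewrite ltW.
- have : 1 <= expR (critical R * Num.max 0 (x t - x r)) by rewrite -expR0 ler_expR.
  nra.
Qed.

End RunBounds.

(** The margin [eta] is small enough for [exp_gap_single] to apply, with an error
    at most [W], to exponents that differ by at most [eta], up to the log-size
    [H], which the first milestones from [|y0| <= Y] cannot exceed.  If the true
    exponent is within [eta] of the maximum, [run_short] allows three milestones;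
    otherwise [milestone_chain_short] allows [N], a number depending only on [eta]
    and on the constant of the run.  Successive milestones grow at most by
    [16 / 5]. *)
Theorem stabilization (R : realType) (W : R) (P : set (R * R)) (bbar : R) :
  0 < W -> P !=set0 -> compact P -> P `<=` @param_space R ->
  ubound (snd @` P) bbar -> bbar <= critical R ->
  forall Y : R, 0 <= Y -> exists Z : R,
    forall (p : R * R) (y0 : R) (w : nat -> R) (t : nat),
      P p -> `|y0| <= Y -> admissible_disturbance W w ->
      `|trajectory (greedy_law W P) p y0 w t| <= Z.
Proof.
move=> W0 Pn0 cP Ppos ubP bbar_le Y Y0.
have /andP[b1 b2] := critical_bounds R.
have [A A1 PA] : exists2 A : R, 1 <= A & forall q, P q -> `|q.1| <= A.
  have [//|//||c _ cmax] := @compact_EVT_max _ R (fun q => `|q.1|) P.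
    by apply: continuous_subspaceT => q; apply: cvg_norm; exact: cvg_fst.
  exists (1 + `|c.1|); first by rewrite lerDl.
  by move=> q Pq; apply: le_trans (cmax q (mem_set Pq)) _; rewrite lerDr.
have P_le q : P q -> [/\ `|q.1| <= A, 0 <= q.2 & q.2 <= bbar].
  by move=> Pq; split; [exact: PA|exact/ltW/Ppos|apply: ubP; exists q].
pose C := ln (2 * A + 60 * W + 1).
have C0 : 0 <= C by rewrite ln_ge0 //; lra.
(* Below [X] the constant [C] is not negligible and no milestone is counted. *)
pose X := 100 * C + 1.
have X1 : 1 <= X by rewrite /X; lra.
have XC : 100 * C <= X by rewrite /X; lra.
pose B := Num.max (log_size Y) (critical R * X + C).
have XB : critical R * X + C <= B by rewrite /B le_max lexx orbT.
have B0 : 0 < B by apply: lt_le_trans XB; nra.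
(* The first three milestones are at most [(16 / 5)^2 B], and the outputs before
   the next one at most [6 / 5] times that. *)
pose H := 13 * B; have H0 : 0 < H by rewrite mulr_gt0.
pose eta := Num.min (4 / 5) (ln (1 + W / (A * expR (critical R * H))) / H).
have Ae0 : 0 < A * expR (critical R * H) by rewrite mulr_gt0 ?expR_gt0 //; lra.
have WA : 0 < W / (A * expR (critical R * H)) by rewrite divr_gt0.
have eta0 : 0 < eta.
  by rewrite lt_min; apply/andP; split; [lra|rewrite divr_gt0 // ln_gt0 // ltrDl].
have eta1 : eta <= 4 / 5 by rewrite ge_min lexx.
have etaH : A * expR (critical R * H) * (expR (eta * H) - 1) <= W.
  rewrite mulrC -ler_pdivlMr // lerBlDl -[leRHS]lnK ?posrE ?addr_gt0 //.
  by rewrite ler_expR -ler_pdivlMr // ge_min lexx orbT.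
have [|N hN] := @milestone_chain_short R eta C; first by rewrite eta0.
exists (expR (6 / 5 * (16 / 5) ^+ maxn N 3 * B)) => p y0 w t Pp yY hw.
have run := greedy_law_run y0 cP Pp hw.
set y := trajectory _ _ _ _ in run *.
pose x t := log_size (y t).
have x0B : x 0%N <= B.
  rewrite /x /y trajectory0 /B le_max; apply/orP; left.
  rewrite /log_size ler_ln ?posrE ?lt_max ?ltr01 //.
  rewrite ge_max le_max lexx /= le_max; apply/orP; right.
  by rewrite (le_trans yY) // ler_norm.
have one := run_one_step W0 A1 P_le bbar_le Pp run.
have [n [tau ms]] := milestones_exist (lt_le_trans ltr01 X1) (fun t => log_size_ge0 (y t)) t.
have xZ : x t <= 6 / 5 * (16 / 5) ^+ maxn N 3 * B.
  apply: (run_bound C0 X1 XC one ms x0B XB); rewrite leq_max.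
  have [peta|peta] := lerP p.2 (bbar - eta).
    apply/orP; left.
    have [||chain|->//] := run_chain C0 X1 XC one ms (ltW eta0).
    - exact: (run_interp W0 A1 P_le bbar_le Pp run).
    - move=> s r q; apply: (run_extrap W0 A1 P_le bbar_le Pp run) => //.
      by rewrite ltW //=; lra.
    exact: hN chain.
  apply/orP; right; apply: (run_short C0 X1 XC one ms x0B XB) => s r rs xr xs.
  exact: (run_single W0 A1 P_le bbar_le Pp run (ltW peta) H0 etaH).
apply: (@le_trans _ _ (expR (x t))); last by rewrite ler_expR.
by rewrite /x /log_size lnK ?posrE ?lt_max ?ltr01 // le_max lexx orbT.
Qed.

Theorem theorem3p1 (R : realType) (W : R) (W_gt0 : 0 < W) :
  (forall (P : set (R * R)) (bbar : R),
    P !=set0 -> compact P -> P `<=` @param_space R ->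
    (snd @` P) bbar -> ubound (snd @` P) bbar ->
    bbar <= 3 * Num.sqrt 3 / 2 ->
    (exists mu : feedback_law R,
      forall Y : R, 0 <= Y ->
        has_ubound
          [set x : R | exists (p : R * R) (y0 : R) (w : nat -> R) (t : nat),
            [/\ P p, `|y0| <= Y, admissible_disturbance W w &
              x = `|trajectory mu p y0 w t|]])
    /\ robustly_stabilizable W P)
  /\
  (forall p0 : R * R,
    3 * Num.sqrt 3 / 2 < p0.2 ->
    ~ locally_robustly_stabilizable W p0
    /\
    (forall (Q : set (R * R)) (mu : feedback_law R) (R0 : R),
      compact_rectangle Q -> Q `<=` @param_space R -> interior Q p0 ->
      0 < R0 ->
      exists (p : R * R) (y0 : R) (w : nat -> R) (c z : R) (T0 : nat),
        [/\ Q p, R0 <= y0, admissible_disturbance W w, 0 < c & 1 < z] /\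
        (forall t : nat, (T0 <= t)%N ->
          c * z ^+ t <= ln `|trajectory mu p y0 w t|) /\
        ~ has_ubound (range (fun t => `|trajectory mu p y0 w t|)))).
Proof.
split=> [P bbar P0 cP Ppos _ ubP bbar_le|p0 p0_gt].
  have bounded := stabilization W_gt0 P0 cP Ppos ubP bbar_le.
  split.
    exists (greedy_law W P) => Y /bounded[Z hZ]; exists Z => x.
    by move=> [p [y0 [w [t [Pp yY hw ->]]]]]; exact: hZ.
  split => //; exists (greedy_law W P) => p y0 w Pp hw.
  have [Z hZ] := bounded `|y0| (normr_ge0 _).
  by exists Z => _ [t _ <-]; exact: hZ.
split=> [[Q [_ _ intQ [_ _ [mu stable]]]]|Q mu R0 _ _ intQ _]; last first.
  exact: (impossibility mu R0 W_gt0 p0_gt intQ).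
have [p [y0 [w [c [z [T0 [[Qp _ hw _ _] [_ unbounded]]]]]]]] :=
  impossibility mu 1 W_gt0 p0_gt intQ.
exact/unbounded/stable.
Qed.
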